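(* Consider the leader $\dot v=\phi(v)\omega$, $q_{N+1}=Ev$, and, for $i=1,\dots,N$, the learning-based distributed observer $$\dot{\hat v}_i=\phi(\hat v_i)\hat\omega_i+\hat\kappa_i\rho_i(z_i)z_i,\quad \dot{\hat\omega}_i=\mu\,\phi^T(\hat v_i)z_i,\quad \dot{\hat\kappa}_i=\rho_i(z_i)z_i^Tz_i,\quad z_i=\sum_{j\in\bar{\mathcal N}_i}(\hat v_j-\hat v_i),$$ with $\hat v_{N+1}=v$, where $\hat v_i\in\mathbb{R}^m$, $\hat\omega_i\in\mathbb{R}^l$, $\hat\kappa_i\in\mathbb{R}$. Then there exist smooth functions $\rho_i:\mathbb{R}^m\to\mathbb{R}$ with $\rho_i\ge1$, $i=1,\dots,N$, such that for every $\mu>0$, every $v(0)\in\mathbb{V}_0$, every $\hat v_i(0)\in\mathbb{V}_0$, every $\hat\omega_i(0)\in\mathbb{R}^l$ and every $\hat\kappa_i(0)\in\mathbb{R}$, the signals $\hat v_i(t),\hat\kappa_i(t),\hat\omega_i(t)$ exist and are bounded on $[0,\infty)$ and, with $\tilde v_i=\hat v_i-v$ and $\tilde\omega_i=\hat\omega_i-\omega$, $$\lim_{t\to\infty}\tilde v_i(t)=0,\qquad \lim_{t\to\infty}\dot{\tilde\omega}_i(t)=0,\qquad \lim_{t\to\infty}\phi(\hat v_i(t))\tilde\omega_i(t)=0,\qquad i=1,\dots,N.$$ Moreover, if $t\mapsto\phi^T(v(t))$ is persistently exciting, then $\lim_{t\to\infty}\tilde\omega_i(t)=0$ for $i=1,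\dots,N$.
   Context: Leader: $v\in\mathbb{R}^m$, $\phi:\mathbb{R}^m\to\mathbb{R}^{m\times l}$ a known smooth function, $\omega\in\mathbb{R}^l$ an unknown constant vector, $E\in\mathbb{R}^{n\times m}$ known; standing assumption: for every compact $\mathbb{V}_0\subset\mathbb{R}^m$ containing the origin there is a compact $\mathbb{V}$ such that every solution with $v(0)\in\mathbb{V}_0$ satisfies $v(t)\in\mathbb{V}$ for all $t\ge0$. Communication graph: $\bar{\mathcal G}=(\bar{\mathcal V},\bar{\mathcal E})$ with $\bar{\mathcal V}=\{1,\dots,N,N+1\}$, node $N+1$ the leader; for $i\in\bar{\mathcal V}$, $j\in\{1,\dots,N\}$, $(i,j)\in\bar{\mathcal E}$ iff node $j$ receives information from node $i$; $\bar{\mathcal N}_i=\{j:(j,i)\in\bar{\mathcal E}\}$. It is assumed that $\bar{\mathcal G}$ contains a spanning tree rooted at node $N+1$ and that the subgraph induced on the followers $\{1,\dots,N\}$ is undirected. Persistent excitation: a bounded piecewise continuous $f:[0,\infty)\to\mathbb{R}^{n\times m}$ is persistently exciting if there exist $\epsilon,t_0,T_0>0$ with $\frac1{T_0}\int_t^{t+T_0}f(s)f^T(s)\,ds\ge\epsilon I_n$ for all $t\ge t_0$. *)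

(* Defs.v *)
From HB Require Import structures.
From mathcomp Require Import all_boot all_order all_algebra.
From mathcomp Require Import all_classical all_reals all_analysis.
Set Implicit Arguments. Unset Strict Implicit. Unset Printing Implicit Defensive.
Import Order.TTheory GRing.Theory Num.Theory.
Import numFieldNormedType.Exports.
Local Open Scope classical_set_scope.
Local Open Scope ring_scope.

Fixpoint Ck {R : realType} {U V : normedModType R} (k : nat) (f : U -> V) : Prop :=
  match k with
  | 0 => continuous f
  | k'.+1 => (forall x, differentiable f x) /\ (forall u : U, Ck k' (fun x => 'd f x u))
  end.

Definition smooth {R : realType} {U V : normedModType R} (f : U -> V) : Prop :=
  forall k, Ck k f.

Definition sol_pos {R : realType} {V : normedModType R} (x : R -> V) (F : R -> V) : Prop :=
  (x t @[t --> 0^'+] --> x 0) /\ (forall t : R, 0 < t -> is_derive t (1:R) x (F t)).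

Definition bounded_pos {R : realType} {V : normedModType R} (x : R -> V) : Prop :=
  exists M : R, forall t : R, 0 <= t -> `|x t| <= M.

(* ---------- communication graph ----------
   Nodes are 'I_N.+1; follower i : 'I_N is node (widen_ord _ i) (values 0..N-1,
   i.e. nodes 1..N of the paper), the leader N+1 is node ord_max (value N).
   G a b  <->  (a,b) is an edge, i.e. node b receives information from node a. *)
Definition leader {N : nat} : 'I_N.+1 := ord_max.
Definition fnode {N : nat} (i : 'I_N) : 'I_N.+1 := widen_ord (leqnSn N) i.

Definition has_spanning_tree_rooted {N : nat} (G : rel 'I_N.+1) (r : 'I_N.+1) : Prop :=
  exists par : 'I_N.+1 -> 'I_N.+1,
    (forall b, b != r -> G (par b) b) /\ (forall b, exists k, iter k par b = r).

Definition admissible_graph {N : nat} (G : rel 'I_N.+1) : Prop :=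
  [/\ forall a, ~~ G a leader,
      (forall i j : 'I_N, G (fnode i) (fnode j) = G (fnode j) (fnode i))
    & has_spanning_tree_rooted G leader].

Definition vext {R : realType} {m N : nat} (v : R -> 'cV[R]_m)
  (vh : 'I_N -> R -> 'cV[R]_m) (j : 'I_N.+1) (t : R) : 'cV[R]_m :=
  match unlift leader j with Some k => vh k t | None => v t end.

Definition zerr {R : realType} {m N : nat} (G : rel 'I_N.+1) (v : R -> 'cV[R]_m)
  (vh : 'I_N -> R -> 'cV[R]_m) (i : 'I_N) (t : R) : 'cV[R]_m :=
  \sum_(j < N.+1 | G j (fnode i)) (vext v vh j t - vh i t).

Definition leader_sol {R : realType} {m l : nat} (phi : 'cV[R]_m -> 'M[R]_(m, l))
  (omega : 'cV[R]_l) (v : R -> 'cV[R]_m) : Prop :=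
  sol_pos v (fun t => phi (v t) *m omega).

Definition leader_assumption {R : realType} {m l : nat}
  (phi : 'cV[R]_m -> 'M[R]_(m, l)) (omega : 'cV[R]_l) : Prop :=
  forall V0 : set 'cV[R]_m, compact V0 -> V0 0 ->
  exists V : set 'cV[R]_m, compact V /\
    forall v0, V0 v0 ->
      (exists v, leader_sol phi omega v /\ v 0 = v0) /\
      (forall v, leader_sol phi omega v -> v 0 = v0 -> forall t, 0 <= t -> V (v t)).

Definition closed_loop_sol {R : realType} {m l N : nat}
  (phi : 'cV[R]_m -> 'M[R]_(m, l)) (omega : 'cV[R]_l) (G : rel 'I_N.+1)
  (rho : 'I_N -> 'cV[R]_m -> R) (mu : R)
  (v : R -> 'cV[R]_m) (vh : 'I_N -> R -> 'cV[R]_m)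
  (omh : 'I_N -> R -> 'cV[R]_l) (kh : 'I_N -> R -> R) : Prop :=
  leader_sol phi omega v /\
  forall i : 'I_N,
    [/\ sol_pos (vh i) (fun t => phi (vh i t) *m omh i t
                           + (kh i t * rho i (zerr G v vh i t)) *: zerr G v vh i t),
        sol_pos (omh i) (fun t => mu *: ((phi (vh i t))^T *m zerr G v vh i t))
      & sol_pos (kh i) (fun t => rho i (zerr G v vh i t)
                           * ((zerr G v vh i t)^T *m zerr G v vh i t) 0 0)].

(* Persistent excitation of a bounded (piecewise) continuous
   f : [0,oo) -> R^{p x q}:
   exists eps, t0, T0 > 0 such that for all t >= t0,
   (1/T0) int_t^{t+T0} f f^T >= eps I_p  (Loewner order, i.e.
   x^T (M - eps I) x >= 0 for all x). The matrix integral is entrywise. *)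
Definition mx_integral {R : realType} {p : nat} (a b : R)
  (F : R -> 'M[R]_p) : 'M[R]_p :=
  \matrix_(i, j) (\int[lebesgue_measure]_(s in `[a, b]) F s i j)%R.

Definition persistently_exciting {R : realType} {p q : nat}
  (f : R -> 'M[R]_(p, q)) : Prop :=
  (exists M : R, forall t, 0 <= t -> `|f t| <= M) /\
  exists eps t0 T0 : R, [/\ 0 < eps, 0 < t0, 0 < T0 &
    forall t, t0 <= t -> forall x : 'cV[R]_p,
      eps * (x^T *m x) 0 0 <=
      (x^T *m (T0^-1 *: mx_integral t (t + T0) (fun s => f s *m (f s)^T)) *m x) 0 0].

(* Main.v *)
Require Import Defs.
From HB Require Import structures.
From mathcomp Require Import all_boot all_order all_algebra.
From mathcomp Require Import all_classical all_reals all_analysis.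
From mathcomp Require Import ring lra.
Set Implicit Arguments. Unset Strict Implicit. Unset Printing Implicit Defensive.
Import Order.TTheory GRing.Theory Num.Theory.
Import numFieldNormedType.Exports.
Local Open Scope classical_set_scope.
Local Open Scope ring_scope.

(* With [z_i] the local disagreement and [~v_i], [~omega_i] the estimation errors,
   the function
     W = - 1/2 sum <z_i, ~v_i> + 1/(2 mu) sum |~omega_i|^2 + 1/2 sum (kappa_i - 1)^2
   is positive definite because the grounded Laplacian is.  Along solutions the
   [~omega_i] and [kappa_i] terms cancel, leaving
     W' = - sum <z_i, (phi (hat v_i) - phi v) omega> - sum rho (z_i) |z_i|^2.
   As [~v] is a bounded linear image of [z] and [phi] is locally Lipschitz, the
   first sum is at most [beta(|z_j|^2) |z_j|^2] for the largest [z_j]; a radial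
   power series [rho] growing faster than [beta] gives [W' <= 0].  Hence all
   errors are bounded, and solutions exist globally: multiplying the error field
   by a cutoff makes it globally Lipschitz while keeping [W' <= 0], so the
   Picard solution never meets the cutoff.  Each [kappa_i] is monotone and
   bounded, so Barbalat gives [z -> 0], thus [~v -> 0]; Barbalat again gives
   [~v' -> 0], thus [phi (hat v_i) ~omega_i -> 0].  Finally [~omega_i' -> 0]
   makes [~omega_i] almost constant over one excitation window, and persistent
   excitation turns [phi v ~omega_i -> 0] into [~omega_i -> 0]. *)

(** * Matrix norms and solutions on the half line *)

Section MatrixNorm.
Context {R : realType}.

Lemma mx_entry_norm_le p q (A : 'M[R]_(p, q)) i j : `|A i j| <= `|A|.
Proof.
rewrite [leRHS]/Num.Def.normr/= mx_normrE.
by apply/bigmax_geP; right; exists (i, j).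
Qed.

Lemma mx_norm_leP p q (A : 'M[R]_(p, q)) M :
  0 <= M -> (forall i j, `|A i j| <= M) -> `|A| <= M.
Proof.
move=> M0 AM; rewrite [leLHS]/Num.Def.normr/= mx_normrE.
by apply: bigmax_le => // -[i j] _; exact: AM.
Qed.

Lemma mulmx_norm_le p q r (A : 'M[R]_(p, q)) (B : 'M[R]_(q, r)) :
  `|A *m B| <= q%:R * (`|A| * `|B|).
Proof.
apply: mx_norm_leP => [|i j]; first by rewrite !mulr_ge0.
rewrite mxE (le_trans (ler_norm_sum _ _ _))//.
rewrite (@le_trans _ _ (\sum_(k < q) `|A| * `|B|))//.
  by apply: ler_sum => k _; rewrite normrM ler_pM// mx_entry_norm_le.
by rewrite sumr_const card_ord mulr_natl.
Qed.

Lemma trmx_norm p q (A : 'M[R]_(p, q)) : `|A^T| = `|A|.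
Proof.
apply/eqP; rewrite eq_le; apply/andP; split; apply: mx_norm_leP => // i j.
  by rewrite mxE mx_entry_norm_le.
by rewrite -[A i j](mxE trmx_key (fun i j => A j i)) mx_entry_norm_le.
Qed.

Lemma is_derive_mxP p q (X : R -> 'M[R]_(p, q)) (D : 'M[R]_(p, q)) (t : R) :
  is_derive t (1 : R) X D <->
  forall i j, is_derive t (1 : R) (fun s => X s i j) (D i j).
Proof.
split => [[dX <-] i j|dX].
  split; first exact: (proj1 (@derivable_mxP _ _ _ _ X t 1) dX).
  by rewrite derive_mx// mxE.
have dX1 : derivable X t 1 by apply: (proj2 (@derivable_mxP _ _ _ _ X t 1)) => i j; have [] := dX i j.
split=> //; rewrite derive_mx//; apply/matrixP => i j.
by rewrite mxE; have [_ ->] := dX i j.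
Qed.

Lemma cvg_mxP {T} (F : set_system T) {FF : Filter F} p q (X : T -> 'M[R]_(p, q))
    (L : 'M[R]_(p, q)) :
  X @ F --> L <-> forall i j, (fun s => X s i j) @ F --> L i j.
Proof.
split => [/cvgrPdist_le XL i j|XL].
  apply/cvgrPdist_le => e /XL; apply: filterS => s.
  by apply: le_trans; have := mx_entry_norm_le (L - X s) i j; rewrite !mxE.
apply/cvgrPdist_le => e e0.
have H : \forall s \near F, forall ij : 'I_p * 'I_q, `|L ij.1 ij.2 - X s ij.1 ij.2| <= e.
  by apply: filter_forall => -[i j] /=; have /cvgrPdist_le/(_ _ e0) := XL i j.
apply: filterS H => s H; apply: mx_norm_leP; first exact: ltW.
by move=> i j; rewrite !mxE; exact: (H (i, j)).
Qed.

End MatrixNorm.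

(** * Calculus and mean value estimates for solutions on the half line *)

Section SolPos.
Context {R : realType}.

Lemma sol_pos_entry p q (X F : R -> 'M[R]_(p, q)) i j :
  sol_pos X F -> sol_pos (fun t => X t i j) (fun t => F t i j).
Proof.
by move=> [/cvg_mxP cX dX]; split => [|t /dX /is_derive_mxP]; [exact: cX|exact].
Qed.

Lemma sol_pos_mx p q (X F : R -> 'M[R]_(p, q)) :
  (forall i j, sol_pos (fun t => X t i j) (fun t => F t i j)) -> sol_pos X F.
Proof.
move=> H; split => [|t t0]; first by apply/cvg_mxP => i j; have [] := H i j.
by apply/is_derive_mxP => i j; have [_ ] := H i j; exact.
Qed.

Lemma sol_pos_cst (V : normedModType R) (c : V) : sol_pos (fun=> c) (fun=> 0).
Proof. by split => [|t _]; [exact: cvg_cst|exact: is_derive_cst]. Qed.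

Lemma sol_posD (V : normedModType R) (x y F G : R -> V) :
  sol_pos x F -> sol_pos y G ->
  sol_pos (fun t => x t + y t) (fun t => F t + G t).
Proof.
move=> [cx dx] [cy dy]; split => [|t t0]; first exact: cvgD.
by have := dx _ t0; have := dy _ t0 => ? ?; exact: is_deriveD.
Qed.

Lemma sol_posB (V : normedModType R) (x y F G : R -> V) :
  sol_pos x F -> sol_pos y G ->
  sol_pos (fun t => x t - y t) (fun t => F t - G t).
Proof.
move=> [cx dx] [cy dy]; split => [|t t0]; first exact: cvgB.
by have := dx _ t0; have := dy _ t0 => ? ?; exact: is_deriveB.
Qed.

Lemma sol_posZ (V : normedModType R) (c : R) (x F : R -> V) :
  sol_pos x F -> sol_pos (fun t => c *: x t) (fun t => c *: F t).
Proof.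
move=> [cx dx]; split => [|t t0]; first exact: cvgZr.
by have := dx _ t0 => ?; exact: is_deriveZ.
Qed.

Lemma sol_posM (x y F G : R -> R) :
  sol_pos x F -> sol_pos y G ->
  sol_pos (fun t => x t * y t) (fun t => x t * G t + y t * F t).
Proof.
move=> [cx dx] [cy dy]; split => [|t t0]; first exact: cvgM.
by have := dx _ t0; have := dy _ t0 => ? ?; exact: is_deriveM.
Qed.

Lemma sol_pos_sum (V : normedModType R) (I : Type) (r : seq I) (P : pred I)
    (x F : I -> R -> V) :
  (forall i, sol_pos (x i) (F i)) ->
  sol_pos (fun t => \sum_(i <- r | P i) x i t) (fun t => \sum_(i <- r | P i) F i t).
Proof.
move=> H; elim: r => [|i r IH].
  have -> : (fun t => \sum_(i <- [::] | P i) x i t) = fun=> 0.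
    by apply/funext => t; rewrite big_nil.
  have -> : (fun t => \sum_(i <- [::] | P i) F i t) = fun=> 0.
    by apply/funext => t; rewrite big_nil.
  exact: sol_pos_cst.
have E (y : I -> R -> V) : (fun t => \sum_(j <- i :: r | P j) y j t) =
    fun t => if P i then y i t + \sum_(j <- r | P j) y j t
             else \sum_(j <- r | P j) y j t.
  by apply/funext => t; rewrite big_cons.
by rewrite !E; case: (P i) => //; exact: sol_posD.
Qed.

Lemma eq_sol_pos (V : normedModType R) (x F G : R -> V) :
  (forall t, 0 < t -> F t = G t) -> sol_pos x F -> sol_pos x G.
Proof. by move=> FG [cx dx]; split => // t t0; rewrite -FG//; exact: dx. Qed.

(** One-sided continuity at [0] is all that [sol_pos] grants there, so continuity has to be taken
    within the interval. *)
Lemma sol_pos_within (V : normedModType R) (x F : R -> V) (a b : R) :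
  sol_pos x F -> 0 <= a -> {within `[a, b], continuous x}.
Proof.
move=> [cx dx] a0.
have : {within `[0, +oo[, continuous x}.
  apply/continuous_within_itvcyP; split => // t; rewrite in_itv/= andbT => t0.
  apply: differentiable_continuous; apply/derivable1_diffP.
  by have [] := dx _ t0.
apply: continuous_subspaceW => t /=; rewrite !in_itv/= => /andP[+ _].
by rewrite andbT; exact: le_trans.
Qed.

Lemma sol_pos_MVT (x F : R -> R) (a b : R) : sol_pos x F -> 0 <= a -> a <= b ->
  exists2 c, a <= c <= b & x b - x a = F c * (b - a) /\ (a < b -> 0 < c).
Proof.
move=> sx a0; rewrite le_eqVlt => /orP[/eqP <-|ab].
  by exists a; rewrite ?lexx ?subrr ?mulr0 ?ltxx.
have [|c] := @MVT _ x F a b ab _ (sol_pos_within sx a0).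
  move=> t; rewrite in_itv/= => /andP[at_ _]; apply: (proj2 sx).
  exact: le_lt_trans a0 at_.
rewrite in_itv/= => /andP[ac cb] E; exists c; first by rewrite !ltW.
by split => // _; exact: le_lt_trans a0 ac.
Qed.

Lemma sol_pos_nonincreasing (x F : R -> R) (a b : R) :
  sol_pos x F -> (forall t, 0 < t -> F t <= 0) -> 0 <= a -> a <= b -> x b <= x a.
Proof.
move=> sx F0 a0 ab; have [c _ [E H]] := sol_pos_MVT sx a0 ab.
move: ab; rewrite le_eqVlt => /orP[/eqP -> //|ab].
by rewrite -subr_le0 E mulr_le0_ge0 ?F0 ?H// subr_ge0 ltW.
Qed.

(** The mean value theorem fails for matrices, but the norm is the maximum of the entries, so an
    intermediate point for each entry separately costs no constant. *)
Lemma sol_pos_lipschitz p q (X F : R -> 'M[R]_(p, q)) M (a b : R) :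
  sol_pos X F -> (forall t, a <= t <= b -> `|F t| <= M) -> 0 <= a -> a <= b ->
  `|X b - X a| <= M * (b - a).
Proof.
move=> sX FM a0 ab; have M0 : 0 <= M.
  by apply: le_trans (FM a _); rewrite ?lexx.
apply: mx_norm_leP => [|i j]; first by rewrite mulr_ge0// subr_ge0.
rewrite !mxE; have [c acb [-> _]] := sol_pos_MVT (sol_pos_entry i j sX) a0 ab.
rewrite normrM [X in _ * X]ger0_norm ?subr_ge0// ler_wpM2r ?subr_ge0//.
by apply: le_trans (FM c acb); exact: mx_entry_norm_le.
Qed.

End SolPos.

(** * Bounded Lipschitz functions *)

Section BoundedLipschitz.
Context {R : realType}.

(** The bound is bundled with the Lipschitz estimate because products and compositions need both.
    Domain and gauge [d] stay abstract so that one calculus serves balls in space, the half line of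
    times, time-state pairs, and mere boundedness. *)
Definition bounded_lipschitz (T : Type) (D : T -> Prop) (d : T -> T -> R)
    (V : normedModType R) (f : T -> V) : Prop :=
  exists2 M : R, 0 <= M & forall x, D x -> `|f x| <= M /\
    forall y, D y -> `|f x - f y| <= M * d x y.

Definition loc_lipschitz (U V : normedModType R) (f : U -> V) : Prop :=
  forall r : R, bounded_lipschitz (fun x => `|x| <= r) (fun x y => `|x - y|) f.

Section Calculus.
Variables (T : Type) (D : T -> Prop) (d : T -> T -> R).
Hypothesis d0 : forall x y, 0 <= d x y.
Local Notation BL := (bounded_lipschitz D d).

Lemma BL_intro (V : normedModType R) (f : T -> V) (M K : R) :
  (forall x, D x -> `|f x| <= M) ->
  (forall x y, D x -> D y -> `|f x - f y| <= K * d x y) -> BL f.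
Proof.
move=> fM fK; exists (`|M| + `|K|); first exact: addr_ge0.
move=> x Dx; split=> [|y Dy].
  by rewrite (le_trans (fM _ Dx))// (le_trans (ler_norm M))// lerDl.
rewrite (le_trans (fK _ _ Dx Dy))// ler_wpM2r// (le_trans (ler_norm K))//.
by rewrite lerDr.
Qed.

Lemma BL_cst (V : normedModType R) (c : V) : BL (fun=> c).
Proof.
apply: (@BL_intro _ _ `|c| 0) => // x y _ _.
by rewrite subrr normr0 mul0r.
Qed.

Lemma eq_BL (V : normedModType R) (f g : T -> V) :
  (forall x, D x -> f x = g x) -> BL f -> BL g.
Proof.
move=> fg [M M0 H]; exists M => // x Dx; have [H1 H2] := H _ Dx.
by rewrite -fg//; split => // y Dy; rewrite -fg//; exact: H2.
Qed.

Lemma BLD (V : normedModType R) (f g : T -> V) :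
  BL f -> BL g -> BL (fun x => f x + g x).
Proof.
move=> [M M0 Hf] [K K0 Hg]; apply: (@BL_intro _ _ (M + K) (M + K)) => [x|x y] Dx.
  by rewrite (le_trans (ler_normD _ _))// lerD//; [case: (Hf _ Dx)|case: (Hg _ Dx)].
move=> Dy; rewrite opprD addrACA (le_trans (ler_normD _ _))// mulrDl lerD//.
  by case: (Hf _ Dx) => _; exact.
by case: (Hg _ Dx) => _; exact.
Qed.

Lemma BL_sum (V : normedModType R) (I : Type) (r : seq I) (P : pred I)
    (f : I -> T -> V) :
  (forall i, BL (f i)) -> BL (fun x => \sum_(i <- r | P i) f i x).
Proof.
move=> H; elim: r => [|i r IH].
  by apply: eq_BL (BL_cst 0) => x _; rewrite big_nil.
case Pi: (P i); last by apply: eq_BL IH => x _; rewrite big_cons Pi.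
by apply: eq_BL (BLD (H i) IH) => x _; rewrite big_cons Pi.
Qed.

Lemma BL_entry p q (f : T -> 'M[R]_(p, q)) i j : BL f -> BL (fun x => f x i j).
Proof.
move=> [M M0 H]; exists M => // x /H[H1 H2]; split=> [|y /H2].
  by apply: le_trans H1; exact: mx_entry_norm_le.
by apply: le_trans; have := mx_entry_norm_le (f x - f y) i j; rewrite !mxE.
Qed.

Lemma BL_mx p q (f : T -> 'M[R]_(p, q)) :
  (forall i j, BL (fun x => f x i j)) -> BL f.
Proof.
move=> H.
have /choice[M HM] : forall ij : 'I_p * 'I_q, exists M : R, 0 <= M /\
    forall x, D x -> `|f x ij.1 ij.2| <= M /\
    forall y, D y -> `|f x ij.1 ij.2 - f y ij.1 ij.2| <= M * d x y.
  by move=> [i j]; have [M M0 HM] := H i j; exists M.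
have Mle ij : M ij <= \sum_ij M ij.
  rewrite (bigD1 ij)//= lerDl sumr_ge0// => kl _; exact: (HM kl).1.
have S0 : 0 <= \sum_ij M ij by apply: sumr_ge0 => ij _; exact: (HM ij).1.
exists (\sum_ij M ij) => // x Dx; split=> [|y Dy].
  apply: mx_norm_leP => // i j; apply: le_trans (Mle (i, j)).
  exact: ((HM (i, j)).2 _ Dx).1.
apply: mx_norm_leP; first exact: mulr_ge0.
move=> i j; rewrite !mxE (@le_trans _ _ (M (i, j) * d x y))//.
  exact: ((HM (i, j)).2 _ Dx).2.
exact: ler_wpM2r.
Qed.

(** The bound on [f] supplies the radius of the ball on which the local Lipschitz constant of [h] is
    taken. *)
Lemma BL_comp (U V : normedModType R) (f : T -> U) (h : U -> V) :
  loc_lipschitz h -> BL f -> BL (fun x => h (f x)).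
Proof.
move=> lh [M M0 H]; have [K K0 HK] := lh M.
apply: (@BL_intro _ _ K (K * M)) => [x /H[fx _]|x y Dx Dy].
  exact: (HK _ fx).1.
have [fx fxy] := H _ Dx; have [fy _] := H _ Dy.
apply: le_trans ((HK _ fx).2 _ fy) _.
by rewrite -mulrA ler_wpM2l// fxy.
Qed.

Lemma BLM (f g : T -> R) : BL f -> BL g -> BL (fun x => f x * g x).
Proof.
move=> [M M0 Hf] [K K0 Hg]; apply: (@BL_intro _ _ (M * K) (M * K + K * M)) => [x|x y] Dx.
  by rewrite normrM ler_pM//; [case: (Hf _ Dx)|case: (Hg _ Dx)].
move=> Dy; have [fx fxy] := Hf _ Dx; have [gx gxy] := Hg _ Dx.
have [gy _] := Hg _ Dy.
have -> : f x * g x - f y * g y = f x * (g x - g y) + g y * (f x - f y) by ring.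
rewrite (le_trans (ler_normD _ _))// mulrDl !normrM -!mulrA.
by rewrite lerD// ler_pM// ?fxy ?gxy.
Qed.

Lemma BLZ p q (c : T -> R) (f : T -> 'M[R]_(p, q)) :
  BL c -> BL f -> BL (fun x => c x *: f x).
Proof.
move=> Bc Bf; apply: BL_mx => i j.
by apply: eq_BL (BLM Bc (BL_entry i j Bf)) => x _; rewrite mxE.
Qed.

Lemma BLN (V : normedModType R) (f : T -> V) : BL f -> BL (fun x => - f x).
Proof.
move=> [M M0 H]; exists M => // x /H[H1 H2]; rewrite normrN; split=> // y /H2.
by rewrite -opprD normrN.
Qed.

Lemma BLB (V : normedModType R) (f g : T -> V) :
  BL f -> BL g -> BL (fun x => f x - g x).
Proof. by move=> Bf Bg; apply: BLD => //; exact: BLN. Qed.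

Lemma BL_mulmx p q r (f : T -> 'M[R]_(p, q)) (g : T -> 'M[R]_(q, r)) :
  BL f -> BL g -> BL (fun x => f x *m g x).
Proof.
move=> Bf Bg; apply: BL_mx => i j.
apply: (@eq_BL _ (fun x => \sum_k f x i k * g x k j)) => [x _|].
  by rewrite mxE.
by apply: BL_sum => k; apply: BLM; exact: BL_entry.
Qed.

Lemma BL_trmx p q (f : T -> 'M[R]_(p, q)) : BL f -> BL (fun x => (f x)^T).
Proof.
move=> Bf; apply: BL_mx => i j; apply: eq_BL (BL_entry j i Bf) => x _.
by rewrite mxE.
Qed.

End Calculus.

Lemma closed_ball_bounded_image m (g : 'cV[R]_m -> R) (r : R) :
  continuous g -> exists2 M : R, 0 <= M & forall x, `|x| <= r -> `|g x| <= M.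
Proof.
(* Compactness is established for the ball of row vectors and carried over by transposition, which
   preserves the norm. *)
move=> cg; pose B := [set w : 'rV[R]_m | `|w| <= r].
have cB : compact B.
  apply: bounded_closed_compact.
    by exists r; split; [exact: num_real|move=> M rM w /= /le_trans; apply; exact: ltW].
  have -> : B = (fun w : 'rV[R]_m => `|w|) @^-1` [set x | x <= r] by [].
  by apply: closed_comp => [w _|]; [exact: norm_continuous|exact: closed_le].
have cgT : continuous (fun w : 'rV[R]_m => g w^T).
  move=> w; apply: continuous_comp; last exact: cg.
  apply/(cvg_mxP (FF := nbhs_filter w)) => i j; rewrite mxE.
  have -> : (fun s : 'rV[R]_m => s^T i j) = fun s => s j i.
    by apply/funext => s; rewrite mxE.
  exact: coord_continuous.
have [M [_ HM]] : bounded_set ((fun w : 'rV[R]_m => g w^T) @` B).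
  apply: compact_bounded; apply: continuous_compact => //.
  exact: continuous_subspaceT.
exists (`|M| + 1); first exact: addr_ge0.
move=> x xr; apply: (HM (`|M| + 1)); first by rewrite (le_lt_trans (ler_norm M))// ltrDl.
by exists x^T; [rewrite /B /mkset trmx_norm|rewrite trmxK].
Qed.

(** Mean value theorem along the segment from [y] to [x], which stays in the ball by convexity.
    Expanding the direction in the canonical basis leaves only the partial derivatives to bound,
    each continuous and hence bounded on the ball. *)
Lemma C1_loc_lipschitz m (f : 'cV[R]_m -> R) : Ck 1 f -> loc_lipschitz f.
Proof.
move=> [df cdf] r.
have cf : continuous f by move=> x; exact: differentiable_continuous.
have [M0 M00 HM0] := closed_ball_bounded_image r cf.
have /choice[M HM] : forall k : 'I_m, exists M : R, 0 <= M /\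
    forall x, `|x| <= r -> `|'d f x (delta_mx k 0)| <= M.
  move=> k; have [M ? ?] := closed_ball_bounded_image r (cdf (delta_mx k 0)).
  by exists M.
apply: (@BL_intro _ _ _ _ _ _ M0 (\sum_k M k)) => // x y xr yr.
pose u := x - y; pose g (s : R) := y + s *: u.
have dg s : is_diff s g (fun h : R => h *: u).
  have H1 : is_diff s (cst y : R -> 'cV[R]_m) 0 by exact: (is_diff_cst y s).
  have H2 : is_diff s ( *:%R ^~ u : R -> 'cV[R]_m) ( *:%R ^~ u) by exact: (is_diff_scalel s u).
  by apply: is_diff_eq (is_diffD H1 H2) _; rewrite add0r.
have dfg (s : R) : is_derive s (1 : R) (f \o g) ('d f (g s) u).
  have dfs : differentiable (f \o g) s by apply: differentiable_comp.
  split; first exact/derivable1_diffP.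
  by rewrite deriveE// diff_comp//= diff_val scale1r.
have cfg : {within `[0, 1], continuous (f \o g)}.
  apply: derivable_within_continuous => s _.
  exact: (@ex_derive _ _ _ _ _ _ _ (dfg s)).
have [c] := @MVT _ (f \o g) (fun s => 'd f (g s) u) 0 1 ltr01 (fun s _ => dfg s) cfg.
rewrite in_itv/= => /andP[c0 c1] /=; rewrite /g scale0r scale1r addr0 subr0 mulr1.
have -> : y + u = x by rewrite /u addrC subrK.
move=> ->.
have cr : `|y + c *: u| <= r.
  have -> : y + c *: u = (1 - c) *: y + c *: x.
    by rewrite /u scalerBr scalerBl scale1r addrAC addrA.
  rewrite (le_trans (ler_normD _ _))// !normrZ !ger0_norm ?(ltW c0) ?subr_ge0 ?(ltW c1)//.
  have -> : r = (1 - c) * r + c * r by ring.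
  by rewrite lerD// ler_wpM2l// ?subr_ge0 ltW.
move: (y + c *: u) cr => w wr.
have -> : 'd f w u = 'd f w (\sum_k u k 0 *: delta_mx k 0).
  congr ('d f w _); rewrite {1}[u]matrix_sum_delta; apply: eq_bigr => k _.
  by rewrite big_ord_recl big_ord0 addr0.
rewrite linear_sum mulr_suml (le_trans (ler_norm_sum _ _ _))//.
apply: ler_sum => k _; rewrite linearZ/= normrM mulrC ler_pM//.
  exact: (HM k).2.
exact: mx_entry_norm_le.
Qed.

Lemma C1_entry m p q (f : 'cV[R]_m -> 'M[R]_(p, q)) i j :
  Ck 1 f -> Ck 1 (fun x => f x i j).
Proof.
move=> [df cdf].
have dfi x : is_diff x (fun x => f x i j) (fun u => 'd f x u i j).
  apply: is_diff_eq; last by [].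
  have -> : (fun x => f x i j) = (fun N : 'M[R]_(p, q) => N i j) \o f by [].
  split; first by apply: differentiable_comp => //; exact: differentiable_coord.
  rewrite diff_comp//; last exact: differentiable_coord.
  (* Taking an entry is packed as a continuous linear map, which is its own differential. *)
  pose c (N : 'M[R]_(p, q)) : R := N i j.
  have lc : linear c by move=> a A B; rewrite /c !mxE.
  pose LM := GRing.isLinear.Build _ _ _ _ _ lc.
  pose L : {linear _ -> _} := HB.pack c LM.
  have -> : (fun N : 'M[R]_(p, q) => N i j : R) = L by [].
  by rewrite diff_lin//; exact: coord_continuous.
split=> [x|u x]; first by have [] := dfi x.
have -> : (fun x => 'd (fun x => f x i j) x u) = fun x => ('d f x u) i j.
  by apply/funext => y; rewrite diff_val.
have /cvg_mxP := cdf u x; exact.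
Qed.

Lemma C1_loc_lipschitz_mx m p q (f : 'cV[R]_m -> 'M[R]_(p, q)) :
  Ck 1 f -> loc_lipschitz f.
Proof.
move=> Cf r; apply: BL_mx => // i j.
exact: (C1_loc_lipschitz (C1_entry i j Cf)).
Qed.

End BoundedLipschitz.

(** * Picard iteration and global existence *)

Section Picard.
Context {R : realType}.

(** Integrating from [-1] makes [0] an interior point, so the antiderivative is differentiable there
    too and continuity at [0] comes for free. *)
Lemma antiderivative_pos (f : R -> R) (y0 : R) : continuous f ->
  exists y : R -> R, y 0 = y0 /\ forall t : R, -1 < t -> is_derive t (1 : R) y (f t).
Proof.
move=> cf; set mu := @lebesgue_measure R.
pose G (t : R) := (\int[mu]_(s in `[(-1 : R), t]) f s)%R.
have dG (t : R) : -1 < t -> is_derive t (1 : R) G (f t).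
  move=> t1; have tt : t < t + 1 by rewrite ltrDl.
  have intf : mu.-integrable `[-1, t + 1] (EFin \o f).
    apply: continuous_compact_integrable; first exact: segment_compact.
    exact: continuous_subspaceT.
  have [dG EG] := continuous_FTC1_closed tt intf t1 (cf t).
  by split; [exact: dG|rewrite -derive1E; exact: EG].
exists (fun t => G t + (y0 - G 0)); split; first by rewrite addrC subrK.
move=> t /dG dGt; have dc := is_derive_cst (y0 - G 0 : R) t (1 : R).
by apply: is_derive_eq (is_deriveD dGt dc) _; exact: addr0.
Qed.

Lemma antiderivative_pos_mx p q (f : R -> 'M[R]_(p, q)) (y0 : 'M[R]_(p, q)) :
  continuous f -> exists y : R -> 'M[R]_(p, q), y 0 = y0 /\ sol_pos y f.
Proof.
move=> cf.
have cfij (ij : 'I_p * 'I_q) : continuous (fun t => f t ij.1 ij.2).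
  by move=> t; have /cvg_mxP := cf t; exact.
have /choice[y Hy] := fun ij => antiderivative_pos (y0 ij.1 ij.2) (cfij ij).
exists (fun t => \matrix_(i, j) y (i, j) t); split.
  by apply/matrixP => i j; rewrite mxE (Hy (i, j)).1.
apply: sol_pos_mx => i j.
have -> : (fun t => (\matrix_(i, j) y (i, j) t) i j) = y (i, j).
  by apply/funext => t; rewrite mxE.
have [_ dy] := Hy (i, j); split => [|t t0]; last by apply: dy; lra.
apply: cvg_at_right_filter; apply: differentiable_continuous.
have d0 : -1 < (0 : R) by lra.
by apply/derivable1_diffP; have [] := dy 0 d0.
Qed.

(** For every entry, taken with either sign, its difference with [h] has nonpositive derivative. *)
Lemma sol_pos_compare p q (X F : R -> 'M[R]_(p, q)) (h dh : R -> R) :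
  sol_pos X F -> sol_pos h dh -> (forall t, 0 < t -> `|F t| <= dh t) ->
  `|X 0| <= h 0 -> forall t, 0 <= t -> `|X t| <= h t.
Proof.
move=> sX sh Fh X0 t t0.
have H1 i j : X t i j - h t <= X 0 i j - h 0.
  apply: (@sol_pos_nonincreasing _ (fun s => X s i j - h s)
    (fun s => F s i j - dh s)) => //; first by apply: sol_posB => //; exact: sol_pos_entry.
  move=> s s0; rewrite subr_le0; apply: le_trans (Fh _ s0).
  by apply: le_trans (ler_norm _) _; exact: mx_entry_norm_le.
have H2 i j : - X t i j - h t <= - X 0 i j - h 0.
  apply: (@sol_pos_nonincreasing _ (fun s => - X s i j - h s)
    (fun s => - F s i j - dh s)) => //.
    apply: sol_posB => //; have := sol_posB (sol_pos_cst (0 : R)) (sol_pos_entry i j sX).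
    by congr sol_pos; apply/funext => s; rewrite sub0r.
  move=> s s0; rewrite subr_le0; apply: le_trans (Fh _ s0).
  by apply: le_trans (ler_norm _) _; rewrite normrN; exact: mx_entry_norm_le.
(* The norm bound asks separately for [0 <= h t], which the entries cannot give when there are
   none. *)
have H3 : h 0 <= h t.
  rewrite -lerN2; apply: (@sol_pos_nonincreasing _ (fun s => - h s) (fun s => - dh s)) => //.
    have := sol_posB (sol_pos_cst (0 : R)) sh.
    by congr sol_pos; apply/funext => s; rewrite sub0r.
  by move=> s /Fh; rewrite oppr_le0; exact: le_trans.
apply: mx_norm_leP => [|i j]; first by apply: le_trans H3; exact: le_trans X0.
have := mx_entry_norm_le (X 0) i j; have := H1 i j; have := H2 i j.
rewrite !ler_norml => ? ? /andP[? ?]; apply/andP; split; lra.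
Qed.

Lemma geometric_cvg p q (u : nat -> 'M[R]_(p, q)) (c : R) :
  (forall n, `|u n.+1 - u n| <= c * 2^-1 ^+ n) ->
  exists w, forall n, `|w - u n| <= 2 * c * 2^-1 ^+ n.
Proof.
move=> H.
have c0 : 0 <= c by have := H 0%N; rewrite expr0 mulr1; exact: le_trans.
(* Subtracting the remaining tail of the geometric series is what makes the induction on [k]
   close. *)
have K n k : `|u (n + k)%N - u n| <= 2 * c * 2^-1 ^+ n - 2 * c * 2^-1 ^+ (n + k).
  elim: k => [|k IH]; first by rewrite addn0 !subrr normr0.
  rewrite addnS -(subrKA (u (n + k)%N)) (le_trans (ler_normD _ _))//.
  have := H (n + k)%N; rewrite exprS.
  by move: (_ ^+ (n + k)) IH => e; lra.
have K' n k : `|u (n + k)%N - u n| <= 2 * c * 2^-1 ^+ n.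
  by apply: le_trans (K n k) _; rewrite gerBl !mulr_ge0// exprn_ge0.
have geo0 : 2 * c * 2^-1 ^+ n @[n --> \oo] --> (0 : R).
  by apply: (@cvg_geometric R (2 * c) 2^-1); rewrite ger0_norm//; lra.
have cu : cvgn u.
  apply/cauchy_cvgP/cauchy_ballP => e e0.
  have /cvgrPdist_lt/(_ _ (divr_gt0 e0 (ltr0Sn _ 1))) := geo0.
  move=> [n _ /(_ n (leqnn _))]; rewrite /= sub0r normrN => Hn.
  exists (u @` [set k | (n <= k)%N], u @` [set k | (n <= k)%N]).
    by split; exists n => // k /= nk; exists k.
  move=> [a b] [/= [k nk <-] [k' nk' <-]]; rewrite -ball_normE /ball_/=.
  have -> : u k - u k' = (u k - u n) - (u k' - u n) by rewrite opprB addrA subrK.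
  rewrite (le_lt_trans (ler_normB _ _))// [ltRHS]splitr.
  have := K' n (k - n)%N; have := K' n (k' - n)%N; rewrite !subnKC//.
  by move=> A B; apply: ltrD; apply: le_lt_trans (le_trans _ (ler_norm _)) Hn.
exists (limn u) => n; apply/ler_addgt0Pr => e e0.
have /cvgrPdist_le/(_ _ e0)[k _ Hk] : u @ \oo --> limn u by [].
rewrite -(subrKA (u (n + k)%N)) (le_trans (ler_normD _ _))// addrC lerD//.
by apply: Hk => /=; exact: leq_addl.
Qed.

Lemma dist_max0_le (s t : R) : `|Num.max s 0 - Num.max t 0| <= `|s - t|.
Proof.
by have [] := leP s 0; have [] := leP t 0; have := ler_norm (s - t);
  have := lerNnormlW (lexx `|s - t|); rewrite ?ler_norml => *; lra.
Qed.

(** Freezing [f] at its value in [0] for negative times yields a function continuous on the whole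
    line, to which [antiderivative_pos_mx] applies. *)
Lemma lipschitz_pos_continuous (V : normedModType R) (f : R -> V) (K : R) :
  (forall s t, 0 <= s -> 0 <= t -> `|f s - f t| <= K * `|s - t|) ->
  continuous (fun t : R => f (Num.max t 0)).
Proof.
move=> fK t; apply/cvgrPdist_le => e e0.
have K1 : 0 < `|K| + 1 by rewrite ltr_pwDr.
near=> s; rewrite (le_trans (fK _ _ _ _)) ?le_max ?lexx ?orbT//.
rewrite (@le_trans _ _ ((`|K| + 1) * `|t - s|))//.
  apply: (@le_trans _ _ (`|K| * `|Num.max t 0 - Num.max s 0|)).
    by rewrite ler_wpM2r// ler_norm.
  by rewrite ler_pM// ?dist_max0_le// lerDl.
rewrite mulrC -ler_pdivlMr//; near: s.
have /cvgrPdist_le : s @[s --> t] --> t by [].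
by apply; exact: divr_gt0.
Unshelve. all: by end_near. Qed.

(** Distances are weighted by [expR (a * t)]: for [a >= 2 * L] the Picard map then halves them on
    the whole half line at once, so no gluing of local solutions is needed. *)
Lemma picard p q (F : R -> 'M[R]_(p, q) -> 'M[R]_(p, q)) (L B : R) x0 :
  (forall s t X Y, `|F s X - F t Y| <= L * (`|s - t| + `|X - Y|)) ->
  (forall t X, `|F t X| <= B) ->
  exists x, x 0 = x0 /\ sol_pos x (fun t => F t (x t)).
Proof.
move=> FL FB.
have B0 : 0 <= B by have := FB 0 0; exact: le_trans.
have L0 : 0 <= L.
  by have := FL 1 0 0 0; rewrite !subr0 normr1 normr0 addr0 mulr1; exact: le_trans.
pose S (y : R -> 'M[R]_(p, q)) :=
  y 0 = x0 /\ forall s t, 0 <= s -> 0 <= t -> `|y s - y t| <= B * `|s - t|.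
(* On [S] the integrand is continuous and the integral stays in [S], thanks to the bound [B] on the
   field. Off [S] any value will do, so that choice gives a total map. *)
have step (y : R -> 'M[R]_(p, q)) :
    exists y', S y -> S y' /\ sol_pos y' (fun t => F t (y t)).
  have [[yx0 ylip]|nS] := pselect (S y); last by exists y.
  have cg : continuous (fun t : R => F (Num.max t 0) (y (Num.max t 0))).
    apply: (@lipschitz_pos_continuous _ (fun t => F t (y t)) (L * (1 + B))) => s t s0 t0.
    apply: le_trans (FL _ _ _ _) _; rewrite -mulrA ler_wpM2l// mulrDl mul1r lerD2l.
    exact: ylip.
  have [y' [y'0 sy']] := antiderivative_pos_mx x0 cg.
  have sy : sol_pos y' (fun t => F t (y t)).
    by apply: eq_sol_pos sy' => t t0; rewrite (max_idPl (ltW t0)).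
  exists y' => _; split => //; split => // s t s0 t0.
  wlog st : s t s0 t0 / s <= t.
    by move=> W; have /orP[/W|/W] := le_total s t; first exact;
       rewrite distrC [`|s - t|]distrC; exact.
  rewrite distrC [`|s - t|]distrC (ger0_norm (_ : 0 <= t - s)) ?subr_ge0//.
  exact: (sol_pos_lipschitz sy).
have {step} /choice[P HP] := step.
pose y n := iter n P (fun=> x0).
have Sy n : S (y n).
  elim: n => [|n IH]; last by have [] := HP _ IH.
  by split => // s t _ _; rewrite subrr normr0 mulr_ge0.
have sy n : sol_pos (y n.+1) (fun t => F t (y n t)) by have [] := HP _ (Sy n).
(* The summand [1] ensures [t <= expR (a * t)], which turns the linear bound on the first increment
   into the weighted one. *)
pose a := 2 * (L + 1).
have sexp c : sol_pos (fun t => c * expR (a * t)) (fun t => c * (a * expR (a * t))).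
  apply: sol_posZ.
  have dexp (t : R) : is_derive t (1 : R) (fun t => expR (a * t)) (a * expR (a * t)).
    have d1 : is_derive t (1 : R) (fun t : R => a * t) a.
      apply: is_derive_eq; exact: mulr1.
    by apply: is_derive_eq (is_derive1_comp (is_derive_expR (a * t)) d1) _; rewrite mulrC.
  split => [|t _]; last exact: dexp.
  apply: cvg_at_right_filter.
  have : {for 0, continuous (fun t : R => expR (a * t))}; last exact.
  by apply: differentiable_continuous; apply/derivable1_diffP; have [] := dexp 0.
have a2 : 2 * L <= a by rewrite /a; lra.
have ge_exp t : 0 <= t -> t <= expR (a * t).
  move=> t0; apply: le_trans (expR_ge1Dx _).
  by rewrite /a; have := mulr_ge0 L0 t0; lra.
have contract (X Y X' Y' : R -> 'M[R]_(p, q)) c : S X' -> S Y' ->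
    sol_pos X' (fun t => F t (X t)) -> sol_pos Y' (fun t => F t (Y t)) ->
    (forall t, 0 <= t -> `|X t - Y t| <= c * expR (a * t)) ->
    forall t, 0 <= t -> `|X' t - Y' t| <= c * 2^-1 * expR (a * t).
  move=> [X'0 _] [Y'0 _] sX sY H.
  have c0 : 0 <= c.
    by have := H 0 (lexx _); rewrite mulr0 expR0 mulr1; exact: le_trans.
  apply: (sol_pos_compare (sol_posB sX sY) (sexp _)) => [t t0|].
    apply: le_trans (FL _ _ _ _) _; rewrite subrr normr0 add0r.
    have := H t (ltW t0); have e0 : 0 <= c * expR (a * t) by rewrite mulr_ge0// expR_ge0.
    move=> /(ler_wpM2l L0) /le_trans; apply.
    rewrite (_ : _ * (a * _) = a / 2 * (c * expR (a * t))); last by ring.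
    by rewrite ler_wpM2r//; lra.
  by rewrite X'0 Y'0 subrr normr0 mulr0 expR0 mulr1 mulr_ge0.
have cauchy n t : 0 <= t -> `|y n.+1 t - y n t| <= B * expR (a * t) * 2^-1 ^+ n.
  move=> t0; rewrite mulrAC; elim: n t t0 => [t t0|n IH].
    rewrite expr0 mulr1; have [y10 ylip] := Sy 1%N.
    have := ylip t 0 t0 (lexx _); rewrite y10 => /le_trans; apply.
    by rewrite subr0 ger0_norm// ler_wpM2l// ge_exp.
  by rewrite exprSr mulrA; exact: (contract _ _ _ _ _ (Sy _) (Sy _) (sy _) (sy _)).
have /choice[w Hw] : forall t, exists w, 0 <= t ->
    forall n, `|w - y n t| <= 2 * (B * expR (a * t)) * 2^-1 ^+ n.
  move=> t; have [t0|] := boolP (0 <= t); last by exists 0.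
  by have [w Hw] := geometric_cvg (fun n => cauchy n t t0); exists w.
have small (c b : R) : (forall n, b <= c * 2^-1 ^+ n) -> b <= 0.
  move=> H; have geo0 : c * 2^-1 ^+ n @[n --> \oo] --> (0 : R).
    by apply: (@cvg_geometric R c 2^-1); rewrite ger0_norm//; lra.
  rewrite -(cvg_lim _ geo0)//; apply: limr_ge; first exact: cvgP geo0.
  exact: nearW.
have Sw : S w.
  split.
    apply/eqP; rewrite -subr_eq0 -normr_le0.
    by apply: (small (2 * (B * expR (a * 0)))) => n; have := Hw 0 (lexx _) n; rewrite (Sy n).1.
  move=> s t s0 t0; rewrite -subr_le0.
  pose c := 2 * (B * expR (a * s)) + 2 * (B * expR (a * t)).
  apply: (small c) => n.
  have -> : w s - w t = (w s - y n s) + (y n s - y n t) - (w t - y n t).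
    by rewrite opprB !subrKA.
  have := ler_normB (w s - y n s + (y n s - y n t)) (w t - y n t).
  have := ler_normD (w s - y n s) (y n s - y n t).
  have := Hw s s0 n; have := Hw t t0 n; have := (Sy n).2 s t s0 t0.
  by rewrite /c; move: (2^-1 ^+ n) => e; lra.
(* [P w] has the derivative [F t (w t)] by construction. That it equals [w] for [t >= 0] follows
   since both are limits of the iterates. *)
have [SPw sPw] := HP _ Sw; exists (P w); split; first exact: SPw.1.
apply: eq_sol_pos sPw => t /ltW t0; congr (F t _); apply/eqP.
rewrite -subr_eq0 -normr_le0; apply: (small (4 * (B * expR (a * t)))) => n.
have := Hw t t0 n.+1.
have H : `|P w t - y n.+1 t| <= 2 * B * 2^-1 ^+ n * 2^-1 * expR (a * t).
  apply: (contract _ _ _ _ _ SPw (Sy n.+1) (HP _ Sw).2 (sy n)) => // s s0.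
  by have := Hw s s0 n; rewrite mulrA mulrAC.
move: H; rewrite exprSr.
have -> : w t - P w t = (w t - y n.+1 t) - (P w t - y n.+1 t).
  by rewrite opprB addrA subrK.
have := ler_normB (w t - y n.+1 t) (P w t - y n.+1 t).
have e0 : 0 <= B * expR (a * t) * 2^-1 ^+ n by rewrite !mulr_ge0// ?expR_ge0// exprn_ge0.
move: (2^-1 ^+ n) e0 => e e0 H1 H2 H3; lra.
Qed.

(** The field is multiplied by a cutoff equal to [1] on the ball of radius [r] and to [0] beyond
    [r + 1]. Along a solution of the modified equation the cutoff is a nonnegative function of time,
    so asking the a priori bound for all rescalings [c] makes it apply to that solution, which
    therefore never sees the cutoff. *)
Lemma global_solution_of_a_priori_bound p q
    (F : R -> 'M[R]_(p, q) -> 'M[R]_(p, q)) (x0 : 'M[R]_(p, q)) (r : R) :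
  (forall r, bounded_lipschitz (fun tx : R * 'M[R]_(p, q) => `|tx.2| <= r)
     (fun a b => `|a.1 - b.1| + `|a.2 - b.2|) (fun tx => F tx.1 tx.2)) ->
  (forall (c : R -> R) x, (forall t, 0 <= c t) -> x 0 = x0 ->
     sol_pos x (fun t => c t *: F t (x t)) -> forall t, 0 <= t -> `|x t| <= r) ->
  exists x, x 0 = x0 /\ sol_pos x (fun t => F t (x t)).
Proof.
move=> /(_ (r + 1))[M M0 HM] bound.
pose chi (X : 'M[R]_(p, q)) := Num.max 0 (Num.min 1 (r + 1 - `|X|)).
have chi0 X : 0 <= chi X by rewrite le_max lexx.
have chi1 X : chi X <= 1 by rewrite ge_max ler01 ge_min lexx.
have chiout X : r + 1 < `|X| -> chi X = 0.
  move=> rX; apply/max_idPl; rewrite ge_min; apply/orP; right.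
  by rewrite subr_le0 ltW.
have clamp (a b : R) : `|Num.max 0 (Num.min 1 a) - Num.max 0 (Num.min 1 b)| <= `|a - b|.
  wlog ab : a b / a <= b.
    by move=> W; have /orP[/W|/W] := le_total a b; first exact;
       rewrite distrC [`|a - b|]distrC; exact.
  rewrite [leRHS]distrC (ger0_norm (_ : 0 <= b - a)) ?subr_ge0// ler_norml.
  have [a1|a1] := leP 1 a; have [b1|b1] := leP 1 b; rewrite ?(max_r ler01).
  - by apply/andP; split; lra.
  - by apply/andP; split; lra.
  - by have [a0|a0] := leP 0 a; apply/andP; split; lra.
  - by have [a0|a0] := leP 0 a; have [b0|b0] := leP 0 b; apply/andP; split; lra.
have chilip X Y : `|chi X - chi Y| <= `|X - Y|.
  apply: le_trans (clamp _ _) _.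
  have -> : r + 1 - `|X| - (r + 1 - `|Y|) = `|Y| - `|X| by ring.
  by rewrite [leRHS]distrC ler_dist_dist.
(* When [Y] lies outside, [chi X] equals [chi X - chi Y] and is controlled by the Lipschitz bound on
   [chi]. *)
have out2 s X Y : `|X| <= r + 1 -> r + 1 < `|Y| -> `|chi X *: F s X| <= M * `|X - Y|.
  move=> Xr Yr; rewrite normrZ mulrC ler_pM//; first by have [] := HM (s, X) Xr.
  by have := chilip X Y; rewrite (chiout Y)// subr0.
(* In the constant [2 * M], one [M] accounts for the variation of [chi] and the other for that of
   [F]. *)
have [||x [x0E sx]] := @picard p q (fun t X => chi X *: F t X) (2 * M) M x0.
- move=> s t X Y.
  have d0 : 0 <= M * `|s - t| by rewrite mulr_ge0.
  have d1 : 0 <= M * `|X - Y| by rewrite mulr_ge0.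
  have [Xr|Xr] := leP `|X| (r + 1); have [Yr|Yr] := leP `|Y| (r + 1).
  + have -> : chi X *: F s X - chi Y *: F t Y =
        (chi X - chi Y) *: F s X + chi Y *: (F s X - F t Y).
      by rewrite scalerBl scalerBr addrA subrK.
    have [/= F1 /(_ (t, Y) Yr)/= F2] := HM (s, X) Xr.
    rewrite (le_trans (ler_normD _ _))// !normrZ.
    have A1 : `|chi X - chi Y| * `|F s X| <= `|X - Y| * M by rewrite ler_pM.
    have A2 : `|chi Y| * `|F s X - F t Y| <= M * (`|s - t| + `|X - Y|).
      by rewrite -[leRHS]mul1r ler_pM// ger0_norm.
    lra.
  + rewrite (chiout Y)// scale0r subr0 (le_trans (out2 _ _ _ Xr Yr))//; lra.
  + rewrite (chiout X)// scale0r sub0r normrN (le_trans (out2 _ _ _ Yr Xr))//.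
    by rewrite distrC; lra.
  + by rewrite !chiout// !scale0r subrr normr0; lra.
- move=> t X; have [Xr|Xr] := leP `|X| (r + 1); last by rewrite chiout// scale0r normr0.
  rewrite normrZ -[leRHS]mul1r ler_pM// ?ger0_norm//.
  by have [] := HM (t, X) Xr.
exists x; split => //; apply: eq_sol_pos (sx) => t t0.
have xr : `|x t| <= r := bound _ _ (fun t => chi0 (x t)) x0E sx t (ltW t0).
have -> : chi (x t) = 1; last by rewrite scale1r.
by rewrite /chi min_l ?max_r//; lra.
Qed.

End Picard.

(** * Smooth radial majorants *)

Section SmoothCalculus.
Context {R : realType}.
Variable U : normedModType R.

Lemma Ck_pred (V : normedModType R) k (f : U -> V) : Ck k.+1 f -> Ck k f.
Proof.
elim: k f => [|k IH] f [df Cdf]; first by move=> x; exact: differentiable_continuous.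
by split => // u; apply: IH; exact: Cdf.
Qed.

Lemma Ck_cst (V : normedModType R) k (c : V) : Ck k (fun _ : U => c).
Proof.
elim: k c => [|k IH] c; first by move=> x; exact: cvg_cst.
split=> [x|u]; first exact: (@differentiable_cst _ _ _ c).
rewrite (_ : (fun x => _) = fun=> 0) //.
by apply/funext => x; rewrite (@diff_cst _ _ _ c).
Qed.

Lemma CkD k (f g : U -> R) : Ck k f -> Ck k g -> Ck k (fun x => f x + g x).
Proof.
elim: k f g => [|k IH] f g; first by move=> cf cg x; apply: cvgD; [exact: cf|exact: cg].
move=> [df Cf] [dg Cg]; split=> [x|u]; first exact: differentiableD.
rewrite (_ : (fun x => _) = fun x => 'd f x u + 'd g x u); first exact: (IH _ _ (Cf u) (Cg u)).
by apply/funext => x; rewrite (@diffD _ _ _ f g).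
Qed.

Lemma CkM k (f g : U -> R) : Ck k f -> Ck k g -> Ck k (fun x => f x * g x).
Proof.
elim: k f g => [|k IH] f g; first by move=> cf cg x; apply: cvgM; [exact: cf|exact: cg].
move=> Cf1 Cg1; have [df Cf] := Cf1; have [dg Cg] := Cg1.
split=> [x|u]; first exact: differentiableM.
rewrite (_ : (fun x => _) = fun x => f x * 'd g x u + g x * 'd f x u).
  exact: (CkD (IH _ _ (Ck_pred Cf1) (Cg u)) (IH _ _ (Ck_pred Cg1) (Cf u))).
by apply/funext => x; rewrite (@diffM _ _ f g).
Qed.

Lemma Ck_sum k (I : Type) (r : seq I) (f : I -> U -> R) :
  (forall i, Ck k (f i)) -> Ck k (fun x => \sum_(i <- r) f i x).
Proof.
move=> Cf; elim: r => [|i r IH].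
  rewrite (_ : (fun x => _) = fun=> 0); first exact: Ck_cst.
  by apply/funext => x; rewrite big_nil.
rewrite (_ : (fun x => _) = fun x => f i x + \sum_(j <- r) f j x); first exact: CkD.
by apply/funext => x; rewrite big_cons.
Qed.

Lemma Ck_linear k (L : {linear U -> R}) : continuous L -> Ck k L.
Proof.
move=> cL; case: k => // k; split => [x|u]; first exact: linear_differentiable.
rewrite (_ : (fun x => _) = fun=> L u); first exact: Ck_cst.
by apply/funext => x; rewrite diff_lin.
Qed.

(** All derivatives of the outer function are given at once as the sequence [g], so the chain rule
    merely raises [j], and the induction on [k] is uniform in [j]. *)
Lemma Ck_comp_tower k (g : nat -> R -> R) (f : U -> R) :
  (forall j (s : R), is_derive s (1 : R) (g j) (g j.+1 s)) ->
  (forall k, Ck k f) -> forall j, Ck k (fun x => g j (f x)).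
Proof.
move=> dg Cf; have dgs j s : differentiable (g j) s.
  by apply/derivable1_diffP; have [] := dg j s.
elim: k => [|k IH] j.
  move=> x; apply: continuous_comp; first exact: (Cf 0%N).
  exact: differentiable_continuous.
split=> [x|u].
  by apply: differentiable_comp; [exact: (Cf 1%N).1|exact: dgs].
rewrite (_ : (fun x => _) = fun x => g j.+1 (f x) * 'd f x u).
  exact: (CkM (IH _) ((Cf k.+1).2 u)).
apply/funext => x; rewrite (@diff_comp _ _ _ _ f (g j)) //=; last exact: (Cf 1%N).1.
by rewrite diff1E// derive1E (@derive_val _ _ _ _ _ _ _ (dg j (f x))) mulrC.
Qed.

End SmoothCalculus.

(** * Entire power series of prescribed growth *)

Section SmoothMajorant.
Context {R : realType}.
Implicit Types a : nat -> R.

(** Infinite radius of convergence, in a form stable under termwise differentiation. *)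
Definition entire_coef a := forall K, 1 <= K -> exists C, forall n, `|a n| * K ^+ n <= C.

(** Doubling [K] absorbs the factor [n.+1], because [n.+1 <= 2 ^ n.+1]. *)
Lemma entire_coef_diffs a : entire_coef a -> entire_coef (pseries_diffs a).
Proof.
move=> ea K K1; have [|C HC] := ea (2 * K); first by lra.
exists C => n; apply: le_trans (HC n.+1).
rewrite /pseries_diffs normrM normr_nat -mulrA mulrCA ler_wpM2l//.
rewrite exprMn ler_pM ?exprn_ge0//; first by lra.
  by rewrite -natrX ler_nat ltnW// ltn_expl.
by rewrite exprS ler_peMl// exprn_ge0; lra.
Qed.

Lemma entire_coef_cvg a x : entire_coef a -> cvgn (pseries a x).
Proof.
(* Since [K] is at least twice the modulus of [x], the series is dominated by a geometric one of
   ratio one half. *)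
move=> ea; pose K := 2 * `|x| + 1.
have K1 : 1 <= K by rewrite /K; have := normr_ge0 x; lra.
have [C HC] := ea _ K1.
have C0 : 0 <= C by apply: le_trans (HC 0%N); rewrite expr0 mulr1.
apply: normed_cvg; apply: (@series_le_cvg _ _ (geometric C 2^-1)) => [n|n|n|].
- exact: normr_ge0.
- by rewrite /= mulr_ge0// exprn_ge0.
- rewrite /= normrM normrX exprVn ler_pdivlMr ?exprn_gt0// -mulrA -exprMn.
  apply: le_trans (HC n); rewrite ler_wpM2l// lerXn2r ?qualifE/= ?mulr_ge0//; rewrite /K.
    by have := normr_ge0 x; lra.
  lra.
by apply: is_cvg_geometric_series; rewrite ger0_norm//; lra.
Qed.

Lemma entire_derive a (x : R) : entire_coef a ->
  is_derive x (1 : R) (fun x => limn (pseries a x)) (limn (pseries (pseries_diffs a) x)).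
Proof.
move=> ea; apply: (@pseries_snd_diffs _ _ (`|x| + 1)).
- exact: entire_coef_cvg.
- exact/entire_coef_cvg/entire_coef_diffs.
- exact/entire_coef_cvg/entire_coef_diffs/entire_coef_diffs.
by rewrite [ltRHS]ger0_norm ?ltrDl// addr_ge0.
Qed.

Lemma entire_ge_term a (x : R) n : entire_coef a -> (forall n, 0 <= a n) ->
  0 <= x -> a n * x ^+ n <= limn (pseries a x).
Proof.
move=> ea a0 x0; have u0 k : 0 <= a k * x ^+ k by rewrite mulr_ge0// exprn_ge0.
have ndec : nondecreasing_seq (pseries a x).
  by apply: nondecreasing_series => *; exact: u0.
apply: le_trans (nondecreasing_cvgn_le ndec (@entire_coef_cvg a x ea) n.+1).
by rewrite /pseries /series/= big_nat_recr//= lerDr sumr_ge0.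
Qed.

(* The term [(2 s / k) ^ n_k] of the series exceeds [beta k.+1] on [k, k+1],
   and the exponents [n_k] are strictly increasing. *)
Lemma entire_majorant (beta : nat -> R) : exists a, [/\ entire_coef a,
  forall n, 0 <= a n & forall s : R, 1 <= s ->
    exists k : nat, s <= k%:R /\ beta k <= limn (pseries a s)].
Proof.
(* The successor makes every increment positive, hence the exponents [nk] strictly increasing and
   each coefficient the work of a single [k]. *)
pose c k := (Num.bound `|beta k.+1|).+1.
pose nk k := \sum_(j < k.+1) c j.
have nkS k : (nk k < nk k.+1)%N.
  by rewrite /nk [X in (_ < X)%N]big_ord_recr/= -[X in (X < _)%N]addn0 ltn_add2l.
have nk_inc i j : (i < j)%N -> (nk i < nk j)%N.
  elim: j => // j IH; rewrite ltnS leq_eqVlt => /orP[/eqP-> //|/IH/ltn_trans]; exact.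
have nk_inj : injective nk.
  move=> i j E; case: (ltngtP i j) => // /nk_inc; rewrite E ltnn //.
have nk_ge k : (k <= nk k)%N.
  by elim: k => // k IH; exact: leq_ltn_trans IH (nkS k).
have nk_beta k : beta k.+1 <= 2 ^+ nk k.
  apply: le_trans (ler_norm _) _.
  apply: le_trans (ltW (archi_boundP (normr_ge0 _))) _.
  have : (Num.bound `|beta k.+1| <= nk k)%N.
    by rewrite /nk big_ord_recr/= (leq_trans (leqnSn _))// leq_addl.
  move=> /leq_trans/(_ (ltnW (ltn_expl (nk k) (ltnSn 1)))).
  by rewrite -(ler_nat R) natrX.
(* Searching up to [n] suffices because [k <= nk k]. The value [k = 0] is excluded, as [k] is a
   denominator. *)
pose a n : R := if [pick k : 'I_n.+1 | (0 < k)%N && (nk k == n)] is Some k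
  then (2 / k%:R) ^+ n else 0.
have a0 n : 0 <= a n.
  by rewrite /a; case: pickP => // k _; rewrite exprn_ge0// divr_ge0.
have ea : entire_coef a.
  (* From [k0] on, the base [2 * K / k] is at most [1]. For smaller [k] the exponent is below
     [nk k0], which bounds those terms. *)
  move=> K K1; pose k0 := Num.bound (2 * K).
  have K2 : 2 * K < k0%:R by apply: archi_boundP; lra.
  exists (1 + (2 * K) ^+ nk k0) => n; rewrite ger0_norm//.
  have P0 : 0 <= (2 * K) ^+ nk k0 by rewrite exprn_ge0//; lra.
  rewrite /a; case: pickP => [k /andP[kp /eqP nkk]|_]; last by rewrite mul0r addr_ge0.
  rewrite -exprMn; have k1 : 1 <= k%:R :> R by rewrite ler1n.
  have [kk0|kk0] := leqP k0 k.
    apply: ler_wpDr => //; apply: exprn_ile1; first by rewrite mulr_ge0 ?divr_ge0//; lra.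
    rewrite mulrAC ler_pdivrMr ?mul1r; last lra.
    by apply: le_trans (ltW K2) _; rewrite ler_nat.
  apply: ler_wpDl => //; apply: (@le_trans _ _ ((2 * K) ^+ n)).
    rewrite lerXn2r ?qualifE/= ?mulr_ge0 ?divr_ge0//; try lra.
    by rewrite mulrAC ler_pdivrMr ?ler_peMr//; lra.
  by rewrite ler_weXn2l//; [lra|rewrite -nkk ltnW// nk_inc].
exists a; split => // s s1; have s0 : 0 <= s by lra.
  have := truncn_itv s0; set k := Num.truncn s => /andP[ks sk].
  exists k.+1; split; first exact: ltW.
  apply: le_trans (@entire_ge_term a s (nk k) ea a0 s0).
  have kp : (0 < k)%N by rewrite truncn_gt0.
  have -> : a (nk k) = (2 / k%:R) ^+ nk k.
    rewrite /a; case: pickP => [k' /andP[_ /eqP/nk_inj ->]//|].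
    have kn : (k < (nk k).+1)%N by rewrite ltnS nk_ge.
    by move=> /(_ (Ordinal kn)); rewrite /= kp eqxx.
  apply: le_trans (nk_beta k) _; rewrite -exprMn lerXn2r ?qualifE/= ?mulr_ge0//.
  by rewrite -mulrA ler_peMr// mulrC ler_pdivlMr ?mul1r ?ltr0n.
Qed.

(** An entire series evaluated at the squared Euclidean norm, a polynomial, is smooth everywhere,
    including at the origin where the norm itself is not. *)
Lemma smooth_radial_majorant m (beta : nat -> R) :
  exists rho : 'cV[R]_m -> R, [/\ smooth rho, forall x, 1 <= rho x &
    forall x, exists k : nat, (x^T *m x) 0 0 <= k%:R /\ beta k <= rho x].
Proof.
have [a [ea a0 Ha]] := entire_majorant beta.
pose sq (x : 'cV[R]_m) := (x^T *m x) 0 0.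
have sqE : sq = fun x => \sum_i x i 0 * x i 0.
  by apply/funext => x; rewrite /sq mxE; apply: eq_bigr => i _; rewrite mxE.
have sq0 x : 0 <= sq x by rewrite sqE sumr_ge0// => i _; rewrite -expr2 sqr_ge0.
pose g j (s : R) := limn (pseries (iter j (@pseries_diffs R) a) s).
have g0 s : 0 <= s -> 0 <= g 0%N s.
  move=> s0; apply: le_trans (@entire_ge_term a s 0%N ea a0 s0).
  by rewrite expr0 mulr1.
(* The series dominates [beta] only from [1] on. The constant [beta 1] covers the unit ball, and [1]
   gives the lower bound on the gain. *)
exists (fun x => 1 + `|beta 1%N| + g 0%N (sq x)); split=> [k|x|x].
- apply: CkD; first exact: Ck_cst.
  apply: Ck_comp_tower => [j s|{}k].
    by apply: entire_derive; elim: j => //= j IH; exact: entire_coef_diffs.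
  have Ccoord i : Ck k (fun x : 'cV[R]_m => x i 0).
    pose c (N : 'cV[R]_m) : R := N i 0.
    have lc : linear c by move=> b A B; rewrite /c !mxE.
    pose LM := GRing.isLinear.Build _ _ _ _ _ lc.
    pose L : {linear _ -> _} := HB.pack c LM.
    by apply: (@Ck_linear _ _ _ L); exact: coord_continuous.
  by rewrite sqE; apply: Ck_sum => i; exact: CkM.
- by have := g0 _ (sq0 x); have := normr_ge0 (beta 1%N); lra.
- have := g0 _ (sq0 x); have := ler_norm (beta 1%N); rewrite -/(sq x).
  have [s1|s1] := leP 1 (sq x); last by exists 1%N; split; [exact: ltW|lra].
  have [k [sk Hk]] := Ha _ s1; exists k; split => //.
  by apply: le_trans Hk _; rewrite ler_wpDl// addr_ge0.
Qed.

End SmoothMajorant.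

(** * The communication graph *)

Section Graph.
Context {R : realType} {N : nat}.
Variable G : rel 'I_N.+1.

Definition node_val (V : zmodType) (r : V) (u : 'I_N -> V) (j : 'I_N.+1) : V :=
  match unlift leader j with Some k => u k | None => r end.

(** For [r = 0] this is minus the grounded Laplacian. It is generic in [V] because the estimates are
    made on one scalar coordinate at a time. *)
Definition graph_err (V : zmodType) (r : V) (u : 'I_N -> V) (i : 'I_N) : V :=
  \sum_(j < N.+1 | G j (fnode i)) (node_val r u j - u i).

Lemma zerrE m (v : R -> 'cV[R]_m) (vh : 'I_N -> R -> 'cV[R]_m) i t :
  zerr G v vh i t = graph_err (v t) (fun k => vh k t) i.
Proof. by []. Qed.

Lemma node_val_fnode (V : zmodType) (r : V) u (i : 'I_N) : node_val r u (fnode i) = u i.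
Proof.
have -> : fnode i = lift leader i by apply/val_inj; rewrite /= /bump leqNgt ltn_ord.
by rewrite /node_val liftK.
Qed.

Lemma node_val_leader (V : zmodType) (r : V) u : node_val r u leader = r.
Proof. by rewrite /node_val unlift_none. Qed.

Lemma node_cases (b : 'I_N.+1) : b = leader \/ exists i : 'I_N, b = fnode i.
Proof.
have [->|bl] := eqVneq b leader; [by left|right].
have bN : (b < N)%N by rewrite ltn_neqAle -ltnS ltn_ord andbT; exact: bl.
by exists (Ordinal bN); apply/val_inj.
Qed.

Lemma graph_err_shift (V : zmodType) (r : V) (u : 'I_N -> V) i :
  graph_err r u i = graph_err 0 (fun k => u k - r) i.
Proof.
apply: eq_bigr => j _; have [->|[k ->]] := node_cases j.
  by rewrite !node_val_leader opprB add0r.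
by rewrite !node_val_fnode opprB addrA subrK.
Qed.

Lemma graph_err_entry m (u : 'I_N -> 'cV[R]_m) i k :
  graph_err 0 u i k 0 = graph_err 0 (fun j => u j k 0) i.
Proof.
rewrite summxE; apply: eq_bigr => j _; rewrite !mxE; congr (_ - _).
by rewrite /node_val; case: unlift => // ; rewrite mxE.
Qed.

Lemma sum_antisym0 (f : 'I_N -> 'I_N -> R) :
  (forall i k, f i k = - f k i) -> \sum_i \sum_k f i k = 0.
Proof.
move=> fN; have : \sum_i \sum_k f i k = - \sum_i \sum_k f i k.
  rewrite [LHS]exchange_big/= -sumrN; apply: eq_bigr => i _.
  by rewrite -sumrN; apply: eq_bigr => k _.
lra.
Qed.

Hypothesis adm : admissible_graph G.

Lemma sum_edges (f : 'I_N.+1 -> 'I_N -> R) :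
  \sum_i \sum_(j < N.+1 | G j (fnode i)) f j i =
  \sum_i \sum_k (if G (fnode k) (fnode i) then f (fnode k) i else 0) +
  \sum_i (if G leader (fnode i) then f leader i else 0).
Proof.
by rewrite -big_split/=; apply: eq_bigr => i _; rewrite big_mkcond big_ord_recr.
Qed.

(** In the difference of both sides, edges between followers contribute antisymmetrically and leader
    edges vanish because the leader carries the value [0]. *)
Lemma graph_err_sym (u w : 'I_N -> R) :
  \sum_i graph_err 0 u i * w i = \sum_i graph_err 0 w i * u i.
Proof.
apply/eqP; rewrite -subr_eq0 -sumrB; apply/eqP.
have -> : \sum_i (graph_err 0 u i * w i - graph_err 0 w i * u i) =
    \sum_i \sum_(j < N.+1 | G j (fnode i)) (node_val 0 u j * w i - node_val 0 w j * u i).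
  apply: eq_bigr => i _; rewrite !mulr_suml -sumrB; apply: eq_bigr => j _; ring.
rewrite sum_edges [X in _ + X]big1 ?addr0; last first.
  by move=> i _; rewrite /= !node_val_leader !mul0r subr0; case: ifP.
apply: sum_antisym0 => i k; have [_ Gsym _] := adm.
by rewrite Gsym !node_val_fnode; case: ifP => _; ring.
Qed.

Definition edge_energy (u : 'I_N -> R) : R :=
  \sum_i \sum_(j < N.+1 | G j (fnode i)) (node_val 0 u j - u i) ^+ 2.

(** With [a = u i] and [b] the value at the neighbour, [2 a (a - b) - (b - a)^2 = a^2 - b^2]. These
    differences cancel over the undirected follower edges and leave squares on the leader edges. *)
Lemma edge_energy_le (u : 'I_N -> R) :
  edge_energy u <= 2 * - \sum_i graph_err 0 u i * u i.
Proof.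
rewrite -subr_ge0.
have -> : 2 * - (\sum_i graph_err 0 u i * u i) - edge_energy u =
    \sum_i \sum_(j < N.+1 | G j (fnode i)) (u i ^+ 2 - node_val 0 u j ^+ 2).
  rewrite -sumrN mulr_sumr -sumrB; apply: eq_bigr => i _.
  rewrite mulr_suml -sumrN mulr_sumr -sumrB; apply: eq_bigr => j _; ring.
rewrite sum_edges sum_antisym0 ?add0r.
  apply: sumr_ge0 => i _; rewrite node_val_leader expr0n subr0.
  by case: ifP => // _; exact: sqr_ge0.
move=> i k; have [_ Gsym _] := adm.
by rewrite Gsym !node_val_fnode; case: ifP => _; ring.
Qed.

Lemma edge_energy_ge0 u : 0 <= edge_energy u.
Proof. by apply: sumr_ge0 => i _; apply: sumr_ge0 => j _; exact: sqr_ge0. Qed.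

Lemma edge_le_energy u (i : 'I_N) j :
  G j (fnode i) -> `|node_val 0 u j - u i| <= Num.sqrt (edge_energy u).
Proof.
move=> Gji; rewrite -sqrtr_sqr ler_wsqrtr// /edge_energy (bigD1 i)//=.
rewrite (bigD1 j)//= -addrA lerDl addr_ge0// sumr_ge0// => k _; first exact: sqr_ge0.
by apply: sumr_ge0 => ? _; exact: sqr_ge0.
Qed.

(** A discrete Poincare inequality: the value at a node is the sum of the increments along its tree
    path from the leader, each at most the square root of the energy. *)
Lemma graph_coercive : exists2 K : R, 0 < K & forall (u : 'I_N -> R) i,
  u i ^+ 2 <= K * - \sum_j graph_err 0 u j * u j.
Proof.
have [_ _ [par [Gpar /choice[d Hd]]]] := adm.
have path_le u k b : iter k par b = leader ->
    `|node_val 0 u b| <= k%:R * Num.sqrt (edge_energy u).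
  elim: k b => [b /= ->|k IH b]; first by rewrite node_val_leader normr0 mul0r.
  (* The parent of the root is arbitrary, so the root is treated apart; its value is [0]. *)
  rewrite iterSr => /IH {}IH; have [->|bl] := eqVneq b leader.
    by rewrite node_val_leader normr0 mulr_ge0// sqrtr_ge0.
  have := Gpar _ bl; have [E|[i bi]] := node_cases b; first by rewrite E eqxx in bl.
  rewrite bi in IH *; move=> /(edge_le_energy u); rewrite node_val_fnode => H.
  have -> : u i = node_val 0 u (par (fnode i)) - (node_val 0 u (par (fnode i)) - u i).
    by rewrite opprB addrC subrK.
  rewrite (le_trans (ler_normB _ _))// -natr1 mulrDl mul1r lerD//.
(* [D] exceeds every path length, and the factor [2] in [K] comes from [edge_energy_le]. *)
pose D := (\sum_b d b)%N.+1.
pose K : R := 2 * D%:R ^+ 2; exists K; first by rewrite mulr_gt0// exprn_gt0.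
move=> u i.
have : `|u i| <= D%:R * Num.sqrt (edge_energy u).
  rewrite -(node_val_fnode 0 u i); apply: le_trans (path_le _ _ _ (Hd _)) _.
  rewrite ler_wpM2r ?sqrtr_ge0// ler_nat /D ltnW// ltnS.
  by rewrite (bigD1 (fnode i))//= leq_addr.
move=> H; have {H} : `|u i| ^+ 2 <= (D%:R * Num.sqrt (edge_energy u)) ^+ 2.
  by rewrite lerXn2r// qualifE/= ?mulr_ge0 ?sqrtr_ge0.
rewrite real_normK ?num_real// exprMn sqr_sqrtr ?edge_energy_ge0// => /le_trans; apply.
have := edge_energy_le u; move=> /(ler_wpM2l (sqr_ge0 D%:R)) /le_trans; apply.
by rewrite mulrA [_ * 2]mulrC.
Qed.

(** At a node where the modulus of [u] is largest, coercivity bounds its square by [K * N * Z] times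
    itself, and one factor cancels. *)
Lemma graph_err_bounded_below : exists2 C : R, 0 <= C & forall (u : 'I_N -> R) (Z : R),
  (forall i, `|graph_err 0 u i| <= Z) -> forall i, `|u i| <= C * Z.
Proof.
have [K K0 HK] := graph_coercive; exists (K * N%:R); first by rewrite mulr_ge0// ltW.
move=> u Z HZ i0; have Z0 : 0 <= Z by apply: le_trans (HZ i0).
have [i _ imax] := @arg_maxP _ _ _ i0 xpredT (fun i => `|u i|) isT.
apply: (le_trans (imax i0 isT)).
have [->|ui0] := eqVneq `|u i| 0; first by rewrite !mulr_ge0// ltW.
have uip : 0 < `|u i| by rewrite lt_def ui0 normr_ge0.
rewrite -(ler_pM2r uip) -expr2 real_normK ?num_real//.
apply: le_trans (HK u i) _; rewrite -!mulrA ler_pM2l//.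
apply: le_trans (ler_norm _) _; rewrite normrN.
apply: le_trans (ler_norm_sum _ _ _) _.
rewrite mulr_natl -[N in _ *+ N]card_ord -sumr_const ler_sum// => j _.
by rewrite normrM ler_pM//; exact: imax.
Qed.

End Graph.

(** * The Lyapunov function *)

Section Dot.
Context {R : realType}.

Definition dot m (x y : 'cV[R]_m) : R := (x^T *m y) 0 0.

Lemma dotE m (x y : 'cV[R]_m) : dot x y = \sum_i x i 0 * y i 0.
Proof. by rewrite /dot mxE; apply: eq_bigr => i _; rewrite mxE. Qed.

Lemma dotC m (x y : 'cV[R]_m) : dot x y = dot y x.
Proof. by rewrite !dotE; apply: eq_bigr => i _; rewrite mulrC. Qed.

Lemma dotDr m (x y z : 'cV[R]_m) : dot x (y + z) = dot x y + dot x z.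
Proof. by rewrite /dot mulmxDr mxE. Qed.

Lemma dotZr m a (x y : 'cV[R]_m) : dot x (a *: y) = a * dot x y.
Proof. by rewrite /dot -scalemxAr mxE. Qed.

Lemma dot_trmx m n (A : 'M[R]_(m, n)) x y : dot y (A^T *m x) = dot x (A *m y).
Proof. by rewrite dotC /dot trmx_mul trmxK -mulmxA. Qed.

Lemma dot_ge0 m (x : 'cV[R]_m) : 0 <= dot x x.
Proof. by rewrite dotE sumr_ge0// => i _; rewrite -expr2 sqr_ge0. Qed.

Lemma sqr_entry_le_dot m (x : 'cV[R]_m) i : x i 0 ^+ 2 <= dot x x.
Proof.
rewrite dotE (bigD1 i)//= -expr2 lerDl sumr_ge0// => j _.
by rewrite -expr2 sqr_ge0.
Qed.

Lemma sqr_norm_le_dot m (x : 'cV[R]_m) : `|x| ^+ 2 <= dot x x.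
Proof.
rewrite -(sqr_sqrtr (dot_ge0 x)) lerXn2r ?qualifE/= ?sqrtr_ge0//.
apply: mx_norm_leP => [|i j]; first exact: sqrtr_ge0.
by rewrite ord1 -sqrtr_sqr ler_wsqrtr// sqr_entry_le_dot.
Qed.

Lemma dot_norm_le m (x y : 'cV[R]_m) : `|dot x y| <= m%:R * (`|x| * `|y|).
Proof.
apply: le_trans (mx_entry_norm_le _ 0 0) _.
by apply: le_trans (mulmx_norm_le _ _) _; rewrite trmx_norm.
Qed.

Lemma norm_le_1Dsqr (x : R) : `|x| <= 1 + x ^+ 2.
Proof.
rewrite -[x ^+ 2]real_normK ?num_real//.
have := sqr_ge0 (`|x| - 2^-1); rewrite sqrrB -mulr_natr; move: (`|x|) => y; nra.
Qed.

Lemma sol_pos_dot m (X Y F H : R -> 'cV[R]_m) :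
  sol_pos X F -> sol_pos Y H ->
  sol_pos (fun t => dot (X t) (Y t)) (fun t => dot (X t) (H t) + dot (Y t) (F t)).
Proof.
move=> sX sY.
have -> : (fun t => dot (X t) (Y t)) = fun t => \sum_i X t i 0 * Y t i 0.
  by apply/funext => t; rewrite dotE.
have -> : (fun t => dot (X t) (H t) + dot (Y t) (F t)) =
    fun t => \sum_i (X t i 0 * H t i 0 + Y t i 0 * F t i 0).
  by apply/funext => t; rewrite !dotE big_split.
by apply: sol_pos_sum => i; apply: sol_posM; exact: sol_pos_entry.
Qed.

End Dot.

Section Lyapunov.
Context {R : realType} {m l N : nat}.
Variables (phi : 'cV[R]_m -> 'M[R]_(m, l)) (omega : 'cV[R]_l) (G : rel 'I_N.+1).
Hypothesis adm : admissible_graph G.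
Variable rho : 'cV[R]_m -> R.
Implicit Types (vt : 'I_N -> 'cV[R]_m) (ot : 'I_N -> 'cV[R]_l) (k : 'I_N -> R).

(** Error dynamics, with [phi (hat v) hat omega - phi v omega] split into a part linear in the
    parameter error, cancelled by the adaptation law, and a mismatch that the gain must dominate. *)
Definition err_v (v : 'cV[R]_m) vt ot k i : 'cV[R]_m :=
  phi (vt i + v) *m ot i + (phi (vt i + v) - phi v) *m omega +
  (k i * rho (graph_err G 0 vt i)) *: graph_err G 0 vt i.

Definition err_o mu (v : 'cV[R]_m) vt i : 'cV[R]_l :=
  mu *: ((phi (vt i + v))^T *m graph_err G 0 vt i).

Definition err_k vt i : R :=
  rho (graph_err G 0 vt i) * dot (graph_err G 0 vt i) (graph_err G 0 vt i).

(** Only the leader is confined to a ball: no bound on [vt] is available before [lyap] is known to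
    decrease. *)
Definition dominates_mismatch (M : R) := forall v vt, `|v| <= M ->
  - \sum_i dot (graph_err G 0 vt i) ((phi (vt i + v) - phi v) *m omega) <=
  \sum_i err_k vt i.

(* The gain offset [1] makes [\sum_i err_k vt i] appear with coefficient [-1]
   in the derivative, which [dominates_mismatch] lets us absorb. *)
Definition lyap mu vt ot k : R :=
  2^-1 * - (\sum_i dot (graph_err G 0 vt i) (vt i)) +
  (2 * mu)^-1 * (\sum_i dot (ot i) (ot i)) + 2^-1 * (\sum_i (k i - 1) ^+ 2).

Definition lyap_deriv mu v vt ot k : R :=
  - (\sum_i dot (graph_err G 0 vt i) (err_v v vt ot k i)) +
  mu^-1 * (\sum_i dot (ot i) (err_o mu v vt i)) + \sum_i (k i - 1) * err_k vt i.

Lemma lyap_deriv_le0 mu M v vt ot k : 0 < mu -> dominates_mismatch M -> `|v| <= M ->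
  lyap_deriv mu v vt ot k <= 0.
Proof.
move=> mu0 dom vM; have := dom v vt vM.
suff -> : lyap_deriv mu v vt ot k =
    - (\sum_i dot (graph_err G 0 vt i) ((phi (vt i + v) - phi v) *m omega)) -
    \sum_i err_k vt i by rewrite subr_le0.
rewrite /lyap_deriv mulr_sumr -!sumrN -!big_split/=; apply: eq_bigr => i _.
rewrite /err_v /err_o /err_k !dotDr !dotZr dot_trmx mulKf ?gt_eqF//; ring.
Qed.

Lemma graph_err_dot_sym vt (wt : 'I_N -> 'cV[R]_m) :
  \sum_i dot (graph_err G 0 vt i) (wt i) = \sum_i dot (graph_err G 0 wt i) (vt i).
Proof.
under eq_bigr do rewrite dotE; under [RHS]eq_bigr do rewrite dotE.
rewrite exchange_big [RHS]exchange_big/=; apply: eq_bigr => c _.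
under eq_bigr do rewrite graph_err_entry; under [RHS]eq_bigr do rewrite graph_err_entry.
exact: graph_err_sym.
Qed.

Lemma sol_pos_graph_err (vt F : 'I_N -> R -> 'cV[R]_m) i :
  (forall j, sol_pos (vt j) (F j)) ->
  sol_pos (fun t => graph_err G 0 (fun j => vt j t) i)
          (fun t => graph_err G 0 (fun j => F j t) i).
Proof.
move=> sv; apply: sol_pos_sum => j; apply: sol_posB; last exact: sv.
by rewrite /node_val; case: unlift => [k|]; [exact: sv|exact: sol_pos_cst].
Qed.

(** The factor [c] is the cutoff of the existence proof; for genuine solutions it is [1]. *)
Lemma sol_pos_lyap mu (c : R -> R) (v : R -> 'cV[R]_m)
    (vt : 'I_N -> R -> 'cV[R]_m) (ot : 'I_N -> R -> 'cV[R]_l) (k : 'I_N -> R -> R) :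
  let V t := vt^~ t in let O t := ot^~ t in let K t := k^~ t in
  (forall i, sol_pos (vt i) (fun t => c t *: err_v (v t) (V t) (O t) (K t) i)) ->
  (forall i, sol_pos (ot i) (fun t => c t *: err_o mu (v t) (V t) i)) ->
  (forall i, sol_pos (k i) (fun t => c t *: err_k (V t) i)) ->
  sol_pos (fun t => lyap mu (V t) (O t) (K t))
          (fun t => c t * lyap_deriv mu (v t) (V t) (O t) (K t)).
Proof.
move=> V O K sv so sk.
pose Fv i t := c t *: err_v (v t) (V t) (O t) (K t) i.
have s1 := sol_pos_sum (index_enum _) xpredT
   (fun i => sol_pos_dot (sol_pos_graph_err i sv) (sv i)).
have s2 := sol_pos_sum (index_enum _) xpredT (fun i => sol_pos_dot (so i) (so i)).
have s3 := sol_pos_sum (index_enum _) xpredT (fun i =>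
  let s := sol_posB (sk i) (sol_pos_cst (1 : R)) in sol_posM s s).
have := sol_posD (sol_posD (sol_posZ (- 2^-1) s1) (sol_posZ (2 * mu)^-1 s2))
  (sol_posZ 2^-1 s3).
have -> : (fun t => lyap mu (V t) (O t) (K t)) = (fun t =>
  - 2^-1 *: (\sum_(i <- index_enum _) dot (graph_err G 0 (vt^~ t) i) (vt i t)) +
  (2 * mu)^-1 *: (\sum_(i <- index_enum _) dot (ot i t) (ot i t)) +
  2^-1 *: (\sum_(i <- index_enum _) (k i t - 1) * (k i t - 1))).
  apply/funext => t; rewrite /lyap mulrN -mulNr; do 2 congr (_ + _).
apply: eq_sol_pos => t t0.
(* The two halves of the product rule agree by symmetry of the grounded Laplacian. *)
have E1 : \sum_i (dot (graph_err G 0 (vt^~ t) i) (Fv i t) +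
    dot (vt i t) (graph_err G 0 (Fv^~ t) i)) =
    2 * (c t * \sum_i dot (graph_err G 0 (vt^~ t) i) (err_v (v t) (V t) (O t) (K t) i)).
  rewrite big_split/=; under [X in _ + X]eq_bigr do rewrite dotC.
  rewrite [X in _ + X]graph_err_dot_sym -mulr2n mulr_natl; congr (_ *+ 2).
  by rewrite mulr_sumr; apply: eq_bigr => i _; rewrite dotZr.
have E2 : \sum_i (dot (ot i t) (c t *: err_o mu (v t) (V t) i) +
    dot (ot i t) (c t *: err_o mu (v t) (V t) i)) =
    2 * (c t * \sum_i dot (ot i t) (err_o mu (v t) (V t) i)).
  by rewrite big_split/= -mulr2n mulr_natl mulr_sumr; congr (_ *+ 2);
    apply: eq_bigr => i _; rewrite dotZr.
have E3 : \sum_i ((k i t - 1) * (c t *: err_k (V t) i - 0) +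
    (k i t - 1) * (c t *: err_k (V t) i - 0)) =
    2 * (c t * \sum_i (k i t - 1) * err_k (V t) i).
  rewrite big_split/= -mulr2n mulr_natl mulr_sumr; congr (_ *+ 2).
  by apply: eq_bigr => i _; rewrite subr0 mulrCA.
transitivity (- 2^-1 * (2 * (c t * \sum_i dot (graph_err G 0 (vt^~ t) i) (err_v (v t) (V t) (O t) (K t) i)))
  + (2 * mu)^-1 * (2 * (c t * \sum_i dot (ot i t) (err_o mu (v t) (V t) i)))
  + 2^-1 * (2 * (c t * \sum_i (k i t - 1) * err_k (V t) i))).
  by rewrite -E1 -E2 -E3.
rewrite /lyap_deriv invfM; move: mu^-1 => nu.
by rewrite /V /O /K; field.
Qed.

Lemma lyap_nonincreasing mu M (c : R -> R) (v : R -> 'cV[R]_m)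
    (vt : 'I_N -> R -> 'cV[R]_m) (ot : 'I_N -> R -> 'cV[R]_l) (k : 'I_N -> R -> R) :
  let V t := vt^~ t in let O t := ot^~ t in let K t := k^~ t in
  0 < mu -> dominates_mismatch M -> (forall t, 0 <= c t) ->
  (forall t, 0 <= t -> `|v t| <= M) ->
  (forall i, sol_pos (vt i) (fun t => c t *: err_v (v t) (V t) (O t) (K t) i)) ->
  (forall i, sol_pos (ot i) (fun t => c t *: err_o mu (v t) (V t) i)) ->
  (forall i, sol_pos (k i) (fun t => c t *: err_k (V t) i)) ->
  forall t, 0 <= t -> lyap mu (V t) (O t) (K t) <= lyap mu (V 0) (O 0) (K 0).
Proof.
move=> V O K mu0 dom c0 vM sv so sk t t0.
apply: (sol_pos_nonincreasing (sol_pos_lyap sv so sk)) => // s s0.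
by rewrite mulr_ge0_le0//; apply: lyap_deriv_le0 dom _ => //; exact/vM/ltW.
Qed.

Lemma lyap_coercive mu (w : R) : 0 < mu -> exists r : R, forall vt ot k,
  lyap mu vt ot k <= w -> forall i, [/\ `|vt i| <= r, `|ot i| <= r & `|k i| <= r].
Proof.
move=> mu0; have [K K0 HK] := @graph_coercive R _ _ adm.
have mu20 : 0 < 2 * mu by rewrite mulr_gt0.
(* Each block of [lyap] is nonnegative, hence at most [w]. Bounding a modulus by [1] plus the square
   avoids roots, and a second [1] undoes the offset in [k i - 1]. *)
exists (2 + `|K * (2 * w)| + `|2 * mu * w| + `|2 * w|) => vt ot k.
rewrite /lyap; set A := - _; set B := \sum_i dot _ _; set D := \sum_i _ ^+ 2.
have AE : A = \sum_(c < m) - \sum_i graph_err G 0 (fun j => vt j c 0) i * vt i c 0.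
  rewrite /A sumrN; congr (- _); under eq_bigr do rewrite dotE.
  rewrite exchange_big/=; apply: eq_bigr => c _; apply: eq_bigr => i _.
  by rewrite graph_err_entry.
have A0' c : 0 <= - \sum_i graph_err G 0 (fun j => vt j c 0) i * vt i c 0.
  have := edge_energy_le adm (fun j => vt j c 0).
  by have := edge_energy_ge0 G (fun j => vt j c 0); lra.
have A0 : 0 <= A by rewrite AE sumr_ge0.
have B0 : 0 <= B by apply: sumr_ge0 => i _; exact: dot_ge0.
have D0 : 0 <= D by apply: sumr_ge0 => i _; exact: sqr_ge0.
have B0' : 0 <= (2 * mu)^-1 * B by rewrite mulr_ge0// invr_ge0 ltW.
move=> H i.
have Hi (x s : R) : x ^+ 2 <= s -> `|x| <= 1 + `|s|.
  by move=> xs; have := norm_le_1Dsqr x; have := ler_norm s; lra.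
have Hv c : `|vt i c 0| <= 1 + `|K * (2 * w)|.
  apply: Hi; apply: le_trans (HK (fun j => vt j c 0) i) _.
  rewrite ler_pM2l//; have -> : 2 * w = 2 * w - A + A by ring.
  have : - (\sum_j graph_err G 0 (fun j => vt j c 0) j * vt j c 0) <= A.
    by rewrite AE [leRHS](bigD1 c)//= lerDl sumr_ge0.
  by lra.
have Ho c : `|ot i c 0| <= 1 + `|2 * mu * w|.
  apply: Hi; apply: le_trans (sqr_entry_le_dot _ _) _.
  have : dot (ot i) (ot i) <= B.
    by rewrite /B (bigD1 i)//= lerDl sumr_ge0// => j _; exact: dot_ge0.
  move=> /le_trans; apply; rewrite -ler_pdivrMl//; lra.
have Hk : `|k i - 1| <= 1 + `|2 * w|.
  apply: Hi; have : (k i - 1) ^+ 2 <= D.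
    by rewrite /D (bigD1 i)//= lerDl sumr_ge0// => j _; exact: sqr_ge0.
  lra.
have n1 := normr_ge0 (K * (2 * w)); have n2 := normr_ge0 (2 * mu * w).
have n3 := normr_ge0 (2 * w); split.
- apply: mx_norm_leP => [|c j]; first lra.
  by rewrite ord1; have := Hv c; lra.
- apply: mx_norm_leP => [|c j]; first lra.
  by rewrite ord1; have := Ho c; lra.
- have := ler_normD (k i - 1) 1; rewrite subrK normr1; lra.
Qed.

End Lyapunov.

(** Let [z i] be the largest disagreement and [j] an integer above its square. Every [vt] is then at
    most [C * (1 + j)], which fixes a Lipschitz constant [L j] for [phi], and the whole mismatch is
    absorbed by the single term of index [i] on the right. *)
Lemma dominating_gain {R : realType} {m l N : nat}
    (phi : 'cV[R]_m -> 'M[R]_(m, l)) (omega : 'cV[R]_l) (G : rel 'I_N.+1) (M : R) :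
  admissible_graph G -> loc_lipschitz phi ->
  exists rho : 'cV[R]_m -> R, [/\ smooth rho, forall x, 1 <= rho x &
    dominates_mismatch phi omega G rho M].
Proof.
move=> adm lphi; have [C C0 HC] := @graph_err_bounded_below R _ _ adm.
have /choice[L HL] : forall j : nat, exists L : R, 0 <= L /\
    forall x y : 'cV[R]_m, `|x| <= `|M| + C * (1 + j%:R) -> `|y| <= `|M| + C * (1 + j%:R) ->
    `|phi x - phi y| <= L * `|x - y|.
  move=> j; have [L L0 HL] := lphi (`|M| + C * (1 + j%:R)).
  by exists L; split => // x y xr yr; exact: (HL x xr).2.
(* The factors [N], [m] and [l] count the summands, the terms of the inner product and those of the
   product with [omega]. *)
pose beta j := N%:R * (m%:R * (l%:R * (L j * C * `|omega|))).
have [rho [srho rho1 Hrho]] := smooth_radial_majorant m beta.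
exists rho; split => // v vt vM.
have [i0 _|noi] := pickP 'I_N; last by rewrite !big1 ?oppr0// => i; have := noi i.
pose z i := graph_err G 0 vt i.
have [i _ imax] := @arg_maxP _ _ _ i0 xpredT (fun i => `|z i|) isT.
have [j [zj betaj]] := Hrho (z i).
have z0 := normr_ge0 (z i); have sqz := sqr_norm_le_dot (z i).
have zj1 : `|z i| <= 1 + j%:R.
  by have := norm_le_1Dsqr `|z i|; rewrite normr_id; move: zj; rewrite -/(dot _ _); lra.
have vtle i' : `|vt i'| <= C * `|z i|.
  apply: mx_norm_leP => [|c d]; first exact: mulr_ge0.
  rewrite ord1; apply: (HC (fun k => vt k c 0)) => i''.
  rewrite -graph_err_entry; apply: le_trans (mx_entry_norm_le _ _ _) _.
  exact: imax.
have Cj0 : C * `|z i| <= C * (1 + j%:R) by rewrite ler_wpM2l.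
have Cj1 : 0 <= C * (1 + j%:R) by rewrite mulr_ge0// addr_ge0.
have lip i' : `|phi (vt i' + v) - phi v| <= L j * (C * `|z i|).
  have MM := ler_norm M.
  apply: le_trans ((HL j).2 _ _ _ _) _.
  - apply: le_trans (ler_normD _ _) _; rewrite addrC lerD//; first exact: le_trans MM.
    exact: le_trans Cj0.
  - by lra.
  - by rewrite addrK ler_wpM2l//; exact: (HL j).1.
have -> : \sum_k err_k G rho vt k = err_k G rho vt i + \sum_(k | k != i) err_k G rho vt k.
  by rewrite (bigD1 i).
have rest0 : 0 <= \sum_(k | k != i) err_k G rho vt k.
  by apply: sumr_ge0 => k _; rewrite mulr_ge0 ?dot_ge0// (le_trans ler01).
rewrite -[leLHS]addr0; apply: lerD => //.
apply: le_trans (ler_norm _) _; rewrite normrN; apply: le_trans (ler_norm_sum _ _ _) _.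
apply: (@le_trans _ _ (beta j * `|z i| ^+ 2)); last first.
  rewrite /err_k; apply: ler_pM => //.
  by rewrite !mulr_ge0//; exact: (HL j).1.
have -> : beta j * `|z i| ^+ 2 =
   (m%:R * (`|z i| * (l%:R * (L j * (C * `|z i|) * `|omega|)))) *+ N.
  by rewrite /beta -[in RHS]mulr_natl; ring.
rewrite -[X in _ *+ X]card_ord -sumr_const ler_sum// => k _.
apply: le_trans (dot_norm_le _ _) _; rewrite ler_wpM2l// ler_pM//; first exact: imax.
by apply: le_trans (mulmx_norm_le _ _) _; rewrite ler_wpM2l// ler_wpM2r.
Qed.

(** * Barbalat's lemma and excitation integrals *)

Section ErrorFieldLipschitz.
Context {R : realType} {m l N : nat}.
Variables (phi : 'cV[R]_m -> 'M[R]_(m, l)) (omega : 'cV[R]_l) (G : rel 'I_N.+1).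
Variables (rho : 'cV[R]_m -> R) (mu : R).
Hypotheses (lphi : loc_lipschitz phi) (lrho : loc_lipschitz rho).
Variables (T : Type) (D : T -> Prop) (d : T -> T -> R).
Hypothesis d0 : forall x y, 0 <= d x y.
Variables (v : T -> 'cV[R]_m) (vt : 'I_N -> T -> 'cV[R]_m).
Variables (ot : 'I_N -> T -> 'cV[R]_l) (k : 'I_N -> T -> R).
Local Notation BL := (bounded_lipschitz D d).
Hypotheses (Bv : BL v) (Bvt : forall i, BL (vt i)) (Bot : forall i, BL (ot i)).
Hypothesis Bk : forall i, BL (k i).

Lemma BL_graph_err i : BL (fun x => graph_err G 0 (vt^~ x) i).
Proof.
apply: BL_sum => // j; apply: BLB => //.
by rewrite /node_val; case: unlift => [k'|]; [exact: Bvt|exact: BL_cst].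
Qed.

Lemma BL_phi_shift i : BL (fun x => phi (vt i x + v x)).
Proof. by apply: BL_comp => //; exact: BLD. Qed.

Lemma BL_rho i : BL (fun x => rho (graph_err G 0 (vt^~ x) i)).
Proof. by apply: BL_comp => //; exact: BL_graph_err. Qed.

(** Over an abstract domain this serves both the field on time-state pairs, for existence, and the
    derivative along a solution, for convergence. *)
Lemma BL_err_v i : BL (fun x => err_v phi omega G rho (v x) (vt^~ x) (ot^~ x) (k^~ x) i).
Proof.
apply: BLD => //; [apply: BLD => //|].
- by apply: BL_mulmx => //; exact: BL_phi_shift.
- apply: BL_mulmx => //; last exact: BL_cst.
  by apply: BLB => //; [exact: BL_phi_shift|exact: BL_comp].
- apply: BLZ => //; last exact: BL_graph_err.
  by apply: BLM => //; exact: BL_rho.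
Qed.

Lemma BL_err_o i : BL (fun x => err_o phi G mu (v x) (vt^~ x) i).
Proof.
apply: BLZ => //; first exact: BL_cst.
apply: BL_mulmx => //; last exact: BL_graph_err.
by apply: BL_trmx => //; exact: BL_phi_shift.
Qed.

Lemma BL_err_k i : BL (fun x => err_k G rho (vt^~ x) i).
Proof.
apply: BLM => //; first exact: BL_rho.
apply: (BL_entry 0 0); apply: BL_mulmx => //; last exact: BL_graph_err.
by apply: BL_trmx => //; exact: BL_graph_err.
Qed.

End ErrorFieldLipschitz.

(** * Lipschitz functions of time and their limits *)

Section TimeLipschitz.
Context {R : realType}.

Definition time_BL (V : normedModType R) (f : R -> V) :=
  bounded_lipschitz (fun t => 0 <= t) (fun s t => `|s - t|) f.

(* For the discrete metric, [bounded_lipschitz] just means bounded. *)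
Definition time_bounded (V : normedModType R) (f : R -> V) :=
  bounded_lipschitz (fun t => 0 <= t) (fun s t => (s != t)%:R) f.

Lemma time_boundedP (V : normedModType R) (f : R -> V) :
  time_bounded f <-> exists M, forall t, 0 <= t -> `|f t| <= M.
Proof.
split=> [[M _ HM]|[M HM]]; first by exists M => t /HM[].
apply: (@BL_intro _ _ _ _ _ _ _ M (2 * M)) => // s t s0 t0.
have [->|_] := eqVneq s t; first by rewrite subrr normr0 mulr0.
by rewrite mulr1 mulrDl mul1r (le_trans (ler_normB _ _))// lerD// HM.
Qed.

Lemma sol_pos_time_BL p q (X F : R -> 'M[R]_(p, q)) :
  sol_pos X F -> time_bounded X -> time_bounded F -> time_BL X.
Proof.
move=> sX [M _ HM] [K _ HK]; apply: (@BL_intro _ _ _ _ _ _ _ M K) => //.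
  by move=> x /HM[].
move=> s t s0 t0; wlog st : s t s0 t0 / s <= t.
  by move=> W; have /orP[/W|/W] := le_total s t; first exact;
     rewrite distrC [`|s - t|]distrC; exact.
rewrite distrC [`|s - t|]distrC (ger0_norm (_ : 0 <= t - s)) ?subr_ge0//.
apply: (sol_pos_lipschitz sX) => // c /andP[sc _].
by have [] := HK c (le_trans s0 sc).
Qed.

Lemma sol_pos_scalar (x F : R -> R) : sol_pos x F ->
  sol_pos (fun t => (x t)%:M : 'M[R]_1) (fun t => (F t)%:M).
Proof.
move=> sx; apply: sol_pos_mx => i j; rewrite !ord1.
by under eq_fun do rewrite mxE mulr1n; under [X in sol_pos _ X]eq_fun do rewrite mxE mulr1n.
Qed.

Lemma sol_pos_time_BL_R (x F : R -> R) :
  sol_pos x F -> time_bounded x -> time_bounded F -> time_BL x.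
Proof.
move=> sx bx bF.
have sc (f : R -> R) : time_bounded f -> time_bounded (fun t => (f t)%:M : 'M[R]_1).
  move=> bf; apply: BL_mx => [//|i j]; rewrite !ord1.
  by apply: eq_BL bf => t _; rewrite mxE mulr1n.
have := sol_pos_time_BL (sol_pos_scalar sx) (sc _ bx) (sc _ bF).
by move=> /(BL_entry 0 0); apply: eq_BL => t _; rewrite mxE mulr1n.
Qed.

Lemma cvg0_dominated (V W : normedModType R) (f : R -> V) (g : R -> W) (K : R) :
  (forall t, 0 < t -> `|f t| <= K * `|g t|) ->
  g t @[t --> +oo] --> (0 : W) -> f t @[t --> +oo] --> (0 : V).
Proof.
move=> fg /cvgrPdist_le g0; apply/cvgrPdist_le => e e0.
have K1 : 0 < `|K| + 1 by rewrite ltr_pwDr.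
near=> t; rewrite sub0r normrN.
have t0 : 0 < t by [].
apply: le_trans (fg _ t0) _; apply: (@le_trans _ _ ((`|K| + 1) * `|g t|)).
  by rewrite ler_wpM2r// (le_trans (ler_norm _))// lerDl.
rewrite mulrC -ler_pdivlMr//.
suff : `|0 - g t| <= e / (`|K| + 1) by rewrite sub0r normrN.
by near: t; apply: g0; exact: divr_gt0.
Unshelve. all: by end_near. Qed.

(** Over a short window the increment of [f] is small, so [g] is small somewhere in it, and the
    Lipschitz bound carries this back to the left end. *)
Lemma barbalat (f g : R -> R) (L : R) :
  sol_pos f g -> time_BL g -> f t @[t --> +oo] --> L -> g t @[t --> +oo] --> (0 : R).
Proof.
move=> sf [K K0 HK] /cvgrPdist_le fL; apply/cvgrPdist_le => e e0.
(* With this length [g] varies by at most [e / 2] over the window, and a tolerance [dl * e / 4] at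
   both ends gives the other half. *)
pose dl := e / (2 * (K + 1)).
have dl0 : 0 < dl by rewrite divr_gt0// mulr_gt0// ltr_wpDl.
have /fL[A [_ HA]] : 0 < dl * e / 4 by rewrite divr_gt0// mulr_gt0.
near=> t; rewrite sub0r normrN.
have t0 : 0 < t by [].
have At : A < t by near: t; exact: (nbhs_pinfty_gt (num_real A)).
have tdl : t <= t + dl by rewrite lerDl ltW.
have [c /andP[tc ctd] [E _]] := sol_pos_MVT sf (ltW t0) tdl.
have H1 := HA t At; have H2 := HA (t + dl) (lt_le_trans At tdl).
have c0 : 0 <= c by apply: le_trans tc; exact: ltW.
have [_ /(_ c c0) H3] := HK t (ltW t0).
have H4 : `|t - c| <= dl by rewrite distrC ger0_norm ?subr_ge0// lerBlDl.
have H5 : K * `|t - c| <= e / 2.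
  apply: (@le_trans _ _ ((K + 1) * dl)); first by rewrite ler_pM// lerDl.
  have -> : (K + 1) * dl = e / 2; last by [].
  by rewrite /dl; field; rewrite gt_eqF// ltr_wpDl.
have H6 : `|g c| <= e / 2.
  rewrite -(ler_pM2r dl0) -[X in _ * X <= _](gtr0_norm dl0) -normrM.
  have -> : g c * dl = f (t + dl) - f t by rewrite E [t + dl]addrC addrK.
  have := ler_normB (L - f t) (L - f (t + dl)).
  have -> : L - f t - (L - f (t + dl)) = f (t + dl) - f t by ring.
  by lra.
have := ler_normD (g t - g c) (g c); rewrite subrK; lra.
Unshelve. all: by end_near. Qed.

Lemma nondecreasing_bounded_cvg (x F : R -> R) :
  sol_pos x F -> (forall t, 0 < t -> 0 <= F t) -> time_bounded x ->
  exists L : R, x t @[t --> +oo] --> L.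
Proof.
move=> sx F0 [M _ HM].
have nd a b : 0 <= a -> a <= b -> x a <= x b.
  move=> a0 ab; rewrite -lerN2.
  apply: (@sol_pos_nonincreasing _ (fun s => - x s) (fun s => - F s)) => //.
    have := sol_posB (sol_pos_cst (0 : R)) sx.
    by congr sol_pos; apply/funext => s; rewrite sub0r.
  by move=> t t0; rewrite oppr_le0 F0.
pose y (t : R) := x (Num.max t 0).
have ynd : {homo y : a b / a <= b}.
  move=> a b ab; apply: nd; first by rewrite le_max lexx orbT.
  by rewrite ge_max !le_max ab lexx orbT.
have yub : has_ubound (range y).
  exists M => _ [t _ <-]; rewrite /y (le_trans (ler_norm _))//.
  by apply: (HM _ _).1; rewrite le_max lexx orbT.
exists (sup (range y)); apply: cvg_trans (nondecreasing_cvgr ynd yub).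
apply: near_eq_cvg; near=> t; rewrite /y; congr x.
by apply/max_idPl.
Unshelve. all: by end_near. Qed.

(** The entrywise integral is the increment of an antiderivative [Y], and the mean value theorem
    applied to the quadratic form of [Y] gives the bound. *)
Lemma quad_mx_integral_le p (F : R -> 'M[R]_p) (x : 'cV[R]_p) (a b B : R) :
  0 < a -> a < b -> time_BL F ->
  (forall s, a <= s <= b -> (x^T *m F s *m x) 0 0 <= B) ->
  (x^T *m mx_integral a b F *m x) 0 0 <= B * (b - a).
Proof.
move=> a0 ab [K K0 HK] FB.
have cF : continuous (fun s : R => F (Num.max s 0)).
  by apply: (@lipschitz_pos_continuous _ _ _ K) => s t s0 t0; exact: (HK s s0).2.
have [Y [_ sY]] := antiderivative_pos_mx 0 cF.
have sYF : sol_pos Y F.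
  by apply: eq_sol_pos sY => t t0; rewrite (max_idPl (ltW t0)).
have -> : mx_integral a b F = Y b - Y a.
  apply/matrixP => i j; rewrite /mx_integral !mxE.
  have sij := sol_pos_entry i j sYF.
  have cij : {within `[a, b], continuous (fun s => F s i j)}.
    have /subspace_eq_continuous : {in `[a, b]%classic,
        (fun s => F (Num.max s 0) i j) =1 (fun s => F s i j)}.
      move=> s; rewrite inE/= in_itv/= => /andP[as_ _].
      by rewrite (max_idPl (le_trans (ltW a0) as_)).
    apply; apply: continuous_subspaceT => s.
    by have /cvg_mxP := cF s; exact.
  have dij : derivable_oo_LRcontinuous (fun s => Y s i j) a b.
    have /continuous_within_itvP := sol_pos_within (b := b) sij (ltW a0).
    move=> /(_ ab)[_ ca cb]; split => // t; rewrite in_itv/= => /andP[at_ _].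
    by have [] := sij.2 t (lt_trans a0 at_).
  rewrite /Rintegral (continuous_FTC2 ab cij dij)//.
  move=> t; rewrite in_itv/= => /andP[at_ _]; rewrite derive1E.
  by have [_ ->] := sij.2 t (lt_trans a0 at_).
have sh : sol_pos (fun s => (x^T *m Y s *m x) 0 0) (fun s => (x^T *m F s *m x) 0 0).
  have E (Z : R -> 'M[R]_p) : (fun s => (x^T *m Z s *m x) 0 0) =
      fun s => \sum_j \sum_i (x i 0 * x j 0) *: (Z s i j : R^o).
    apply/funext => s; rewrite mxE; apply: eq_bigr => j _.
    rewrite mxE mulr_suml; apply: eq_bigr => i _; rewrite mxE.
    by rewrite mulrAC.
  rewrite !E; apply: sol_pos_sum => j; apply: sol_pos_sum => i.
  by apply: sol_posZ; exact: sol_pos_entry.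
have [c /FB cB [E _]] := sol_pos_MVT sh (ltW a0) (ltW ab).
by rewrite mulmxBr mulmxBl [leLHS]mxE [X in _ + X]mxE E ler_wpM2r// subr_ge0 ltW.
Qed.

End TimeLipschitz.

(** * Convergence *)

Section ClosedLoop.
Context {R : realType} {m l N : nat}.
Variables (phi : 'cV[R]_m -> 'M[R]_(m, l)) (omega : 'cV[R]_l) (G : rel 'I_N.+1).
Variables (rho : 'cV[R]_m -> R) (mu M : R).
Hypotheses (adm : admissible_graph G) (mu0 : 0 < mu).
Hypotheses (lphi : loc_lipschitz phi) (lrho : loc_lipschitz rho).
Hypotheses (rho1 : forall x, 1 <= rho x) (dom : dominates_mismatch phi omega G rho M).

Lemma err_v_shift v (vh : 'I_N -> 'cV[R]_m) (omh : 'I_N -> 'cV[R]_l) k i :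
  err_v phi omega G rho v (fun j => vh j - v) (fun j => omh j - omega) k i =
  phi (vh i) *m omh i + (k i * rho (graph_err G v vh i)) *: graph_err G v vh i -
  phi v *m omega.
Proof.
rewrite /err_v -graph_err_shift subrK mulmxBr mulmxBl addrA subrK.
by rewrite -addrA [X in _ + X]addrC addrA.
Qed.

Section Convergence.
Variables (v : R -> 'cV[R]_m) (vh : 'I_N -> R -> 'cV[R]_m).
Variables (omh : 'I_N -> R -> 'cV[R]_l) (kh : 'I_N -> R -> R).
Hypothesis sol : closed_loop_sol phi omega G (fun=> rho) mu v vh omh kh.
Hypothesis vM : forall t, 0 <= t -> `|v t| <= M.

Let vt i t := vh i t - v t.
Let ot i t := omh i t - omega.
Let z i t := graph_err G 0 (vt^~ t) i.
Let ev i t := err_v phi omega G rho (v t) (vt^~ t) (ot^~ t) (kh^~ t) i.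
Let eo i t := err_o phi G mu (v t) (vt^~ t) i.
Let ek i t := err_k G rho (vt^~ t) i.

Let sol_vt i : sol_pos (vt i) (ev i).
Proof.
have [sv /(_ i)[svh _ _]] := sol.
by apply: eq_sol_pos (sol_posB svh sv) => t _; rewrite /ev err_v_shift.
Qed.

Let sol_ot i : sol_pos (ot i) (eo i).
Proof.
have [sv /(_ i)[_ so _]] := sol.
apply: eq_sol_pos (sol_posB so (sol_pos_cst omega)) => t _.
by rewrite subr0 /eo /err_o -graph_err_shift subrK.
Qed.

Let sol_kh i : sol_pos (kh i) (ek i).
Proof.
have [sv /(_ i)[_ _ sk]] := sol.
by apply: eq_sol_pos sk => t _; rewrite /ek /err_k -graph_err_shift.
Qed.

Let bounded_states : exists r : R, forall t, 0 <= t -> forall i,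
  [/\ `|vt i t| <= r, `|ot i t| <= r & `|kh i t| <= r].
Proof.
pose w := lyap G mu (vt^~ 0) (ot^~ 0) (kh^~ 0).
have [r Hr] := @lyap_coercive R m l N G adm mu w mu0.
exists r => t t0 i; apply: (Hr (vt^~ t) (ot^~ t) (kh^~ t)).
apply: (@lyap_nonincreasing _ _ _ _ phi omega G adm rho mu M (fun=> 1) v) => //.
- by move=> j; apply: eq_sol_pos (sol_vt j) => s _; rewrite scale1r.
- by move=> j; apply: eq_sol_pos (sol_ot j) => s _; rewrite scale1r.
- by move=> j; apply: eq_sol_pos (sol_kh j) => s _; rewrite scale1r.
Qed.

Let disc0 (s t : R) : 0 <= (s != t)%:R :> R. Proof. exact: ler0n. Qed.
Let dist0 (s t : R) : 0 <= `|s - t|. Proof. exact: normr_ge0. Qed.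

Let tb_v : time_bounded v. Proof. by apply/time_boundedP; exists M. Qed.
Let tb_vt i : time_bounded (vt i).
Proof. by have [r H] := bounded_states; apply/time_boundedP; exists r => t /H /(_ i)[]. Qed.
Let tb_ot i : time_bounded (ot i).
Proof. by have [r H] := bounded_states; apply/time_boundedP; exists r => t /H /(_ i)[]. Qed.
Let tb_kh i : time_bounded (kh i).
Proof. by have [r H] := bounded_states; apply/time_boundedP; exists r => t /H /(_ i)[]. Qed.

(** With the discrete metric the [BL] calculus bounds the derivative, which in turn gives the
    Lipschitz estimate in time. The same scheme handles the other signals. *)
Let bl_v : time_BL v.
Proof.
apply: sol_pos_time_BL (proj1 sol) tb_v _.
by apply: BL_mulmx disc0 _ _ _ _ _ _ _; [exact: BL_comp|exact: BL_cst].
Qed.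

Let bl_vt i : time_BL (vt i).
Proof. by apply: sol_pos_time_BL (sol_vt i) (tb_vt i) _; exact: BL_err_v. Qed.
Let bl_ot i : time_BL (ot i).
Proof. by apply: sol_pos_time_BL (sol_ot i) (tb_ot i) _; exact: BL_err_o. Qed.
Let bl_kh i : time_BL (kh i).
Proof. by apply: sol_pos_time_BL_R (sol_kh i) (tb_kh i) _; exact: BL_err_k. Qed.

Let ek_cvg0 i : ek i t @[t --> +oo] --> (0 : R).
Proof.
have [|L kL] := nondecreasing_bounded_cvg (sol_kh i) _ (tb_kh i).
  by move=> t _; rewrite mulr_ge0 ?dot_ge0// (le_trans ler01).
by apply: (barbalat (sol_kh i) _ kL); exact: BL_err_k.
Qed.

(** As [rho >= 1], the derivative of the gain dominates the squared disagreement. *)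
Let z_cvg0 i : z i t @[t --> +oo] --> (0 : 'cV[R]_m).
Proof.
apply/cvgrPdist_le => e e0; have /cvgrPdist_le/(_ _ (exprn_gt0 2 e0)) := ek_cvg0 i.
apply: filterS => t; rewrite !sub0r !normrN => H.
rewrite -(@ler_pXn2r _ 2)// ?qualifE/= ?(ltW e0)//.
apply: le_trans (le_trans (ler_norm _) H); apply: le_trans (sqr_norm_le_dot _) _.
by rewrite ler_peMl ?dot_ge0.
Qed.

Let vt_cvg0 i : vt i t @[t --> +oo] --> (0 : 'cV[R]_m).
Proof.
have [C C0 HC] := @graph_err_bounded_below R _ _ adm.
apply/cvgrPdist_le => e e0; have C1 : 0 < C + 1 by rewrite ltr_wpDl.
have H : \forall t \near +oo, forall j, `|z j t| <= e / (C + 1).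
  apply: filter_forall => j; have /cvgrPdist_le/(_ _ (divr_gt0 e0 C1)) := z_cvg0 j.
  by apply: filterS => t; rewrite sub0r normrN.
apply: filterS H => t H; rewrite sub0r normrN; apply: mx_norm_leP (ltW e0) _ => c d.
rewrite ord1; have := HC (fun j => vt j t c 0) (e / (C + 1)).
move=> /(_ _ i)/le_trans; apply.
  move=> j; rewrite -graph_err_entry; apply: le_trans (H j); exact: mx_entry_norm_le.
by rewrite mulrCA ger_pMr// ler_pdivrMr// mul1r lerDl.
Qed.

Let ev_cvg0 i : ev i t @[t --> +oo] --> (0 : 'cV[R]_m).
Proof.
apply/cvg_mxP => c d; rewrite mxE.
apply: (barbalat (sol_pos_entry c d (sol_vt i))).
  by apply: BL_entry; exact: BL_err_v.
by have /cvg_mxP H := vt_cvg0 i; exact: (H c d).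
Qed.

Let phi_lip i : exists K : R, forall t, 0 <= t ->
  `|phi (vh i t) - phi (v t)| <= K * `|vt i t|.
Proof.
have [r [_ Hr]] : exists r : R, 0 <= r /\ forall t, 0 <= t ->
    `|vh i t| <= r /\ `|v t| <= r.
  have [r1 r10 H1] := tb_vt i; exists (r1 + `|M|); split; first exact: addr_ge0.
  move=> t t0; have [H2 _] := H1 t t0; have := vM t0; have := ler_norm M.
  have := ler_normD (vt i t) (v t); rewrite subrK; split; lra.
by have [K _ HK] := lphi r; exists K => t /Hr[H1 H2]; exact: (HK _ H1).2.
Qed.

Let phi_bounded i : exists K : R, forall t, 0 <= t -> `|phi (vh i t)| <= K.
Proof.
apply/time_boundedP; have := BL_phi_shift lphi disc0 tb_v tb_vt i.
by apply: eq_BL => t _; rewrite subrK.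
Qed.

(** The error equation is solved for this term: the derivative, the mismatch and the coupling all
    vanish in the limit. *)
Let phi_ot_cvg0 i : phi (vh i t) *m ot i t @[t --> +oo] --> (0 : 'cV[R]_m).
Proof.
have [K HK] := phi_lip i.
have [B HB] : exists B : R, forall t, 0 <= t -> `|kh i t * rho (z i t)| <= B.
  by apply/time_boundedP; exact: (BLM disc0 (tb_kh i) (BL_rho G lrho disc0 tb_vt i)).
have -> : (fun t => phi (vh i t) *m ot i t) = (fun t => ev i t -
    (phi (vh i t) - phi (v t)) *m omega - (kh i t * rho (z i t)) *: z i t).
  by apply/funext => t; rewrite /ev /err_v subrK [RHS]addrAC !addrK.
have -> : (0 : 'cV[R]_m) = 0 - 0 - 0 by rewrite !subr0.
apply: cvgB; [apply: cvgB => //|].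
- apply: (@cvg0_dominated _ _ _ _ (vt i) (l%:R * (K * `|omega|))) (vt_cvg0 i) => t t0.
  apply: le_trans (mulmx_norm_le _ _) _; rewrite -mulrA ler_wpM2l// mulrAC.
  by rewrite ler_wpM2r// HK// ltW.
- apply: (@cvg0_dominated _ _ _ _ (z i) B) (z_cvg0 i) => t t0.
  by rewrite normrZ ler_wpM2r// HB// ltW.
Qed.

Let eo_cvg0 i : eo i t @[t --> +oo] --> (0 : 'cV[R]_l).
Proof.
have [K HK] := phi_bounded i.
apply: (@cvg0_dominated _ _ _ _ (z i) (mu * (m%:R * K))) (z_cvg0 i) => t t0.
rewrite /eo /err_o subrK normrZ (gtr0_norm mu0) -!mulrA ler_pM2l//.
apply: le_trans (mulmx_norm_le _ _) _; rewrite trmx_norm ler_wpM2l// ler_wpM2r//.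
by rewrite HK// ltW.
Qed.

(** The parameter error is frozen at the left end [t] of the excitation window as [x]. Its drift is
    at most [eta * T], so [phi (v s) *m x] is small throughout the window, and excitation bounds [x]
    itself. *)
Let pe_ot_cvg0 i : persistently_exciting (fun t => (phi (v t))^T) ->
  ot i t @[t --> +oo] --> (0 : 'cV[R]_l).
Proof.
move=> [[P HP] [eps [t1 [T [eps0 t10 T0 PE]]]]].
have P0 : 0 <= P by apply: le_trans (HP 0 (lexx _)).
have phiv_ot : phi (v t) *m ot i t @[t --> +oo] --> (0 : 'cV[R]_m).
  have [K HK] := phi_lip i; have [B B0 HB] := tb_ot i.
  have -> : (fun t => phi (v t) *m ot i t) = (fun t => phi (vh i t) *m ot i t -
      (phi (vh i t) - phi (v t)) *m ot i t).
    by apply/funext => t; rewrite mulmxBl opprB addrC subrK.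
  have -> : (0 : 'cV[R]_m) = 0 - 0 by rewrite subr0.
  apply: cvgB; first exact: phi_ot_cvg0.
  apply: (@cvg0_dominated _ _ _ _ (vt i) (l%:R * (B * K))) (vt_cvg0 i) => t t0.
  apply: le_trans (mulmx_norm_le _ _) _; rewrite -mulrA ler_wpM2l//.
  have H1 := HK t (ltW t0); have [H2 _] := HB t (ltW t0).
  by rewrite [leLHS]mulrC -mulrA; apply: ler_pM.
have blF : time_BL (fun t => (phi (v t))^T *m ((phi (v t))^T)^T).
  have blphi : time_BL (fun t => phi (v t)) by exact: BL_comp.
  by apply: BL_mulmx dist0 _ _ _ _ _ _ _; do ?apply: BL_trmx.
pose A := m%:R * (1 + l%:R * (P * T)) ^+ 2.
have A0 : 0 <= A by rewrite mulr_ge0// sqr_ge0.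
have epsA : 0 < eps + A by rewrite ltr_pwDl.
apply/cvgrPdist_le => e e0.
(* The choice gives [A * c ^+ 2 <= A * c <= eps], hence [B <= eps * e ^+ 2] below, without a square
   root. *)
pose c := eps / (eps + A); pose eta := e * c.
have c0 : 0 < c by rewrite divr_gt0.
have c1 : c <= 1 by rewrite ler_pdivrMr// mul1r lerDl.
have eta0 : 0 < eta by rewrite mulr_gt0.
have /cvgrPdist_le/(_ _ eta0)[a1 [_ Ha1]] := phiv_ot.
have /cvgrPdist_le/(_ _ eta0)[a2 [_ Ha2]] := eo_cvg0 i.
near=> t; rewrite sub0r normrN.
have t0 : 0 < t by [].
have t1t : t1 <= t by near: t; exact: (nbhs_pinfty_ge (num_real t1)).
have a1t : a1 < t by near: t; exact: (nbhs_pinfty_gt (num_real a1)).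
have a2t : a2 < t by near: t; exact: (nbhs_pinfty_gt (num_real a2)).
have tT : t < t + T by rewrite ltrDl.
pose x := ot i t.
have small s : t <= s <= t + T -> `|phi (v s) *m x| <= eta * (1 + l%:R * (P * T)).
  move=> /andP[ts sT].
  have E (Q : 'M[R]_(m, l)) (a b : 'cV[R]_l) : Q *m b = Q *m a - Q *m (a - b).
    by rewrite mulmxBr opprB addrC subrK.
  rewrite (E _ (ot i s) x).
  apply: le_trans (ler_normB _ _) _; rewrite mulrDr mulr1; apply: lerD.
    by have := Ha1 s (lt_le_trans a1t ts); rewrite sub0r normrN.
  apply: le_trans (mulmx_norm_le _ _) _; rewrite [leRHS]mulrCA ler_wpM2l//.
  rewrite [leRHS]mulrCA; apply: ler_pM => //.
    have := HP s (le_trans (ltW t0) ts); by rewrite trmx_norm.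
  apply: (@le_trans _ _ (eta * (s - t))); last by rewrite ler_pM2l// lerBlDl.
  apply: (sol_pos_lipschitz (sol_ot i)) => //.
  move=> s' /andP[ts' _].
  by have := Ha2 s' (lt_le_trans a2t ts'); rewrite sub0r normrN.
have := PE t t1t x; rewrite -/(dot x x).
pose B := m%:R * (eta * (1 + l%:R * (P * T))) ^+ 2.
have quad : (x^T *m mx_integral t (t + T)
    (fun s => (phi (v s))^T *m ((phi (v s))^T)^T) *m x) 0 0 <= B * (t + T - t).
  apply: quad_mx_integral_le => // s Hs.
  have -> : (x^T *m ((phi (v s))^T *m (phi (v s))^T^T) *m x) 0 0 =
      dot (phi (v s) *m x) (phi (v s) *m x).
    by rewrite /dot trmxK trmx_mul !mulmxA.
  apply: le_trans (ler_norm _) _; apply: le_trans (dot_norm_le _ _) _.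
  by rewrite ler_wpM2l// expr2 ler_pM// small.
rewrite -scalemxAr -scalemxAl [leRHS]mxE => H.
have {H} H : eps * dot x x <= B.
  apply: le_trans H _; rewrite mulrC ler_pdivrMr//.
  by apply: le_trans quad _; rewrite [t + T]addrC addrK.
have BA : B <= eps * e ^+ 2.
  have -> : B = e ^+ 2 * (A * c ^+ 2) by rewrite /B /A /eta; ring.
  rewrite mulrC ler_wpM2r ?sqr_ge0//; apply: (@le_trans _ _ (A * c)).
    by rewrite ler_wpM2l// expr2 ger_pMl.
  by rewrite /c mulrCA ger_pMr// ler_pdivrMr// mul1r lerDr ltW.
rewrite -(@ler_pXn2r _ 2)// ?qualifE/= ?(ltW e0)//.
apply: le_trans (sqr_norm_le_dot _) _; rewrite -(ler_pM2l eps0).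
exact: le_trans H BA.
Unshelve. all: by end_near. Qed.

Lemma closed_loop_convergence :
  (forall i : 'I_N,
    [/\ bounded_pos (vh i), bounded_pos (kh i) & bounded_pos (omh i)] /\
    [/\ (vh i t - v t) @[t --> +oo] --> (0 : 'cV[R]_m),
        'D_1 (fun s => omh i s - omega) t @[t --> +oo] --> (0 : 'cV[R]_l)
      & phi (vh i t) *m (omh i t - omega) @[t --> +oo] --> (0 : 'cV[R]_m)]) /\
  (persistently_exciting (fun t => (phi (v t))^T) ->
   forall i : 'I_N, (omh i t - omega) @[t --> +oo] --> (0 : 'cV[R]_l)).
Proof.
split=> [i|pe i]; last exact: pe_ot_cvg0.
have [r Hr] := bounded_states.
split; split.
- exists (r + M) => t t0; have [H _ _] := Hr t t0 i.
  rewrite -[vh i t](subrK (v t)); apply: le_trans (ler_normD _ _) _.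
  by rewrite lerD// vM.
- by exists r => t t0; have [] := Hr t t0 i.
- exists (r + `|omega|) => t t0; have [_ H _] := Hr t t0 i.
  rewrite -[omh i t](subrK omega); apply: le_trans (ler_normD _ _) _.
  by rewrite lerD2r.
- exact: vt_cvg0.
- apply: cvg_trans (eo_cvg0 i); apply: near_eq_cvg; near=> t.
  have t0 : 0 < t by [].
  by have [_ Dt] := (sol_ot i).2 t t0; exact/esym/Dt.
- exact: phi_ot_cvg0.
Unshelve. all: by end_near. Qed.

End Convergence.

End ClosedLoop.

(** * Existence of closed-loop solutions *)

Section Existence.
Context {R : realType} {m l N : nat}.
Variables (phi : 'cV[R]_m -> 'M[R]_(m, l)) (omega : 'cV[R]_l) (G : rel 'I_N.+1).
Variables (rho : 'cV[R]_m -> R) (mu M : R).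
Hypotheses (adm : admissible_graph G) (mu0 : 0 < mu).
Hypotheses (lphi : loc_lipschitz phi) (lrho : loc_lipschitz rho).
Hypothesis dom : dominates_mismatch phi omega G rho M.
Variable v : R -> 'cV[R]_m.
Hypotheses (sv : leader_sol phi omega v) (vM : forall t, 0 <= t -> `|v t| <= M).

(* Column [i] of the state stacks the errors of observer [i] in [hat v_i] and
   [hat omega_i], and its gain. *)
Local Notation state := 'M[R]_(m + (l + 1), N).

Let sV (X : state) i : 'cV[R]_m := \col_a X (lshift _ a) i.
Let sO (X : state) i : 'cV[R]_l := \col_a X (rshift _ (lshift _ a)) i.
Let sK (X : state) i : R := X (rshift _ (rshift _ 0)) i.

Let pack (V : 'I_N -> 'cV[R]_m) (O : 'I_N -> 'cV[R]_l) (K : 'I_N -> R) : state :=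
  \matrix_(a, i) (col_mx (V i) (col_mx (O i) (K i)%:M)) a 0.

Let sV_pack V O K i : sV (pack V O K) i = V i.
Proof. by apply/colP => a; rewrite mxE mxE col_mxEu. Qed.
Let sO_pack V O K i : sO (pack V O K) i = O i.
Proof. by apply/colP => a; rewrite mxE mxE col_mxEd col_mxEu. Qed.
Let sK_pack V O K i : sK (pack V O K) i = K i.
Proof. by rewrite /sK mxE !col_mxEd mxE. Qed.

(** [v] is unconstrained at negative times, whereas the Picard field must be Lipschitz over all real
    times. *)
Let w (t : R) := v (Num.max t 0).
Let F (t : R) (X : state) : state :=
  pack (err_v phi omega G rho (w t) (sV X) (sO X) (sK X))
       (err_o phi G mu (w t) (sV X)) (err_k G rho (sV X)).

Let wM t : `|w t| <= M.
Proof. by apply: vM; rewrite le_max lexx orbT. Qed.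

Let w_lipschitz : exists K : R, 0 <= K /\ forall s t, `|w s - w t| <= K * `|s - t|.
Proof.
have tbv : time_bounded v by apply/time_boundedP; exists M.
have d0 (s t : R) : 0 <= (s != t)%:R :> R by exact: ler0n.
have [K K0 HK] : time_BL v.
  apply: sol_pos_time_BL sv (tbv) _.
  by apply: BL_mulmx d0 _ _ _ _ _ _ _; [exact: BL_comp|exact: BL_cst].
exists K; split => // s t; have p0 (a : R) : 0 <= Num.max a 0 by rewrite le_max lexx orbT.
apply: le_trans ((HK _ (p0 s)).2 _ (p0 t)) _.
by rewrite ler_wpM2l// dist_max0_le.
Qed.

Let F_BL r : bounded_lipschitz (fun tx : R * state => `|tx.2| <= r)
  (fun a b => `|a.1 - b.1| + `|a.2 - b.2|) (fun tx => F tx.1 tx.2).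
Proof.
pose D (tx : R * state) := is_true (`|tx.2| <= r).
pose d (a b : R * state) := `|a.1 - b.1| + `|a.2 - b.2|.
rewrite -/D -/d.
have d0 a b : 0 <= d a b by rewrite addr_ge0.
have BX : bounded_lipschitz D d (fun tx => tx.2).
  by apply: (@BL_intro _ _ _ _ d0 _ _ r 1) => // a b _ _; rewrite mul1r lerDr.
have Bw : bounded_lipschitz D d (fun tx => w tx.1).
  have [K [K0 HK]] := w_lipschitz.
  apply: (@BL_intro _ _ _ _ d0 _ _ M K) => [tx _|a b _ _]; first exact: wM.
  by apply: le_trans (HK _ _) _; rewrite ler_wpM2l// lerDl.
have BV i : bounded_lipschitz D d (fun tx => sV tx.2 i).
  apply: BL_mx => // a j; apply: eq_BL (BL_entry (lshift _ a) i BX) => tx _.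
  by rewrite mxE.
have BO i : bounded_lipschitz D d (fun tx => sO tx.2 i).
  apply: BL_mx => // a j; apply: eq_BL (BL_entry (rshift _ (lshift _ a)) i BX) => tx _.
  by rewrite mxE.
have BK i : bounded_lipschitz D d (fun tx => sK tx.2 i) by exact: BL_entry.
apply: BL_mx => // a i; rewrite -[a]splitK; case: (fintype.split a) => [a'|a'].
  apply: eq_BL (BL_entry a' 0 (BL_err_v omega G lphi lrho d0 Bw BV BO BK i)) => tx _.
  by rewrite /= [RHS]mxE col_mxEu.
rewrite -[a']splitK; case: (fintype.split a') => [b|b].
  apply: eq_BL (BL_entry b 0 (BL_err_o G mu lphi d0 Bw BV i)) => tx _.
  by rewrite /= [RHS]mxE col_mxEd col_mxEu.
apply: eq_BL (BL_err_k G lrho d0 BV i) => tx _.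
by rewrite /= [RHS]mxE !col_mxEd !ord1 mxE.
Qed.

Let F_components (c : R -> R) (X : R -> state) i :
  sol_pos X (fun t => c t *: F t (X t)) ->
  [/\ sol_pos (fun t => sV (X t) i) (fun t => c t *:
        err_v phi omega G rho (w t) (sV (X t)) (sO (X t)) (sK (X t)) i),
      sol_pos (fun t => sO (X t) i) (fun t => c t *: err_o phi G mu (w t) (sV (X t)) i) &
      sol_pos (fun t => sK (X t) i) (fun t => c t *: err_k G rho (sV (X t)) i)].
Proof.
move=> sX; split.
- apply: sol_pos_mx => a j; rewrite ord1.
  have := sol_pos_entry (lshift _ a) i sX.
  congr sol_pos; apply/funext => t; first by rewrite mxE.
  by rewrite mxE mxE col_mxEu [RHS]mxE.
- apply: sol_pos_mx => a j; rewrite ord1.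
  have := sol_pos_entry (rshift _ (lshift _ a)) i sX.
  congr sol_pos; apply/funext => t; first by rewrite mxE.
  by rewrite mxE mxE col_mxEd col_mxEu [RHS]mxE.
- have := sol_pos_entry (rshift _ (rshift _ 0)) i sX.
  by congr sol_pos; apply/funext => t; rewrite mxE mxE !col_mxEd mxE.
Qed.

(** The leader trajectory is given and enters as a time dependence, so only errors and gains are
    solved for, the variables that [lyap] controls. *)
Lemma closed_loop_existence (vh0 : 'I_N -> 'cV[R]_m) (om0 : 'I_N -> 'cV[R]_l)
    (k0 : 'I_N -> R) :
  exists vh omh kh, closed_loop_sol phi omega G (fun=> rho) mu v vh omh kh /\
    forall i, [/\ vh i 0 = vh0 i, omh i 0 = om0 i & kh i 0 = k0 i].
Proof.
pose X0 := pack (fun i => vh0 i - v 0) (fun i => om0 i - omega) k0.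
have [r Hr] := @lyap_coercive R m l N G adm mu (lyap G mu (sV X0) (sO X0) (sK X0)) mu0.
have [|X [X0E sX]] := @global_solution_of_a_priori_bound R _ _ F X0 `|r| F_BL.
  move=> c X c0 X0E sX t t0.
  (* The rescaling [c] multiplies the derivative of [lyap] by a nonnegative factor and so preserves
     its sign. *)
  have H : lyap G mu (sV (X t)) (sO (X t)) (sK (X t)) <= lyap G mu (sV X0) (sO X0) (sK X0).
    rewrite -X0E.
    apply: (@lyap_nonincreasing _ _ _ _ phi omega G adm rho mu M c w (fun i t => sV (X t) i)
      (fun i t => sO (X t) i) (fun i t => sK (X t) i)) => // i.
    - by have [] := F_components i sX.
    - by have [] := F_components i sX.
    - by have [] := F_components i sX.
  apply: mx_norm_leP => // a i; have [HV HO HK] := Hr _ _ _ H i.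
  apply: le_trans _ (ler_norm r); rewrite -[a]splitK; case: (fintype.split a) => [a'|a'].
    by apply: le_trans HV; have := mx_entry_norm_le (sV (X t) i) a' 0; rewrite mxE.
  rewrite -[a']splitK; case: (fintype.split a') => [b|b].
    by apply: le_trans HO; have := mx_entry_norm_le (sO (X t) i) b 0; rewrite mxE.
  by rewrite ord1.
have sX1 : sol_pos X (fun t => 1 *: F t (X t)).
  by apply: eq_sol_pos sX => t _; rewrite scale1r.
have wE t : 0 < t -> w t = v t by move=> t0; rewrite /w (max_idPl (ltW t0)).
pose vh i t := sV (X t) i + v t; pose omh i t := sO (X t) i + omega.
have vhK t : (fun j => vh j t - v t) = sV (X t) by apply/funext => j; rewrite addrK.
have omhK t : (fun j => omh j t - omega) = sO (X t) by apply/funext => j; rewrite addrK.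
exists vh, omh, (fun i t => sK (X t) i); split; last first.
  by move=> i; rewrite /vh /omh X0E sV_pack sO_pack sK_pack !subrK.
split => // i; have [sv1 so1 sk1] := F_components (c := fun=> 1) i sX1; split.
- apply: eq_sol_pos (sol_posD sv1 sv) => t t0.
  by rewrite scale1r wE// -vhK -omhK err_v_shift -zerrE subrK.
- apply: eq_sol_pos (sol_posD so1 (sol_pos_cst omega)) => t t0.
  by rewrite addr0 scale1r wE// /err_o -vhK -graph_err_shift -zerrE subrK.
- apply: eq_sol_pos sk1 => t t0.
  by rewrite scale1r /err_k -vhK -graph_err_shift -zerrE.
Qed.

End Existence.

Theorem theorem1 (R : realType) (m l n N : nat)
  (phi : 'cV[R]_m -> 'M[R]_(m, l)) (omega : 'cV[R]_l) (E : 'M[R]_(n, m))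
  (G : rel 'I_N.+1) :
  smooth phi ->
  leader_assumption phi omega ->
  admissible_graph G ->
  forall V0 : set 'cV[R]_m, compact V0 -> V0 0 ->
  exists rho : 'I_N -> 'cV[R]_m -> R,
    (forall i, smooth (rho i) /\ forall x, 1 <= rho i x) /\
    forall mu : R, 0 < mu ->
      (* existence of the closed-loop signals on [0, +oo) *)
      (forall (v0 : 'cV[R]_m) (vh0 : 'I_N -> 'cV[R]_m)
              (om0 : 'I_N -> 'cV[R]_l) (k0 : 'I_N -> R),
         V0 v0 -> (forall i, V0 (vh0 i)) ->
         exists v vh omh kh,
           closed_loop_sol phi omega G rho mu v vh omh kh /\
           v 0 = v0 /\ (forall i, [/\ vh i 0 = vh0 i, omh i 0 = om0 i & kh i 0 = k0 i])) /\
      (* boundedness and convergence of every such solution *)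
      (forall v vh omh kh,
         closed_loop_sol phi omega G rho mu v vh omh kh ->
         V0 (v 0) -> (forall i, V0 (vh i 0)) ->
         (forall i : 'I_N,
            [/\ bounded_pos (vh i), bounded_pos (kh i) & bounded_pos (omh i)] /\
            [/\ (vh i t - v t) @[t --> +oo] --> (0 : 'cV[R]_m),
                'D_1 (fun s => omh i s - omega) t @[t --> +oo] --> (0 : 'cV[R]_l)
              & phi (vh i t) *m (omh i t - omega) @[t --> +oo] --> (0 : 'cV[R]_m)]) /\
         (persistently_exciting (fun t => (phi (v t))^T) ->
          forall i : 'I_N, (omh i t - omega) @[t --> +oo] --> (0 : 'cV[R]_l))).
Proof.
move=> sphi lead adm V0 cV0 V00.
have [V [cV HV]] := lead V0 cV0 V00.
(* [M] bounds all leader trajectories issued from [V0] together, so the gain can be fixed before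
   [mu] and the initial data. *)
have [M0 [_ HM0]] := compact_bounded cV; pose M := `|M0| + 1.
have VM x : V x -> `|x| <= M.
  by apply: HM0; rewrite /M (le_lt_trans (ler_norm _))// ltrDl.
have lphi : loc_lipschitz phi := C1_loc_lipschitz_mx (sphi 1%N).
have [rho [srho rho1 dom]] := dominating_gain omega M adm lphi.
have lrho : loc_lipschitz rho := C1_loc_lipschitz (srho 1%N).
exists (fun=> rho); split => // mu mu0; split.
  move=> v0 vh0 om0 k0 Vv0 _; have [[v [sv v0E]] Hv] := HV v0 Vv0.
  have vM t : 0 <= t -> `|v t| <= M by move=> t0; apply: VM; exact: Hv.
  have [vh [omh [kh [Hsol Hinit]]]] :=
    closed_loop_existence adm mu0 lphi lrho dom sv vM vh0 om0 k0.
  by exists v, vh, omh, kh.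
move=> v vh omh kh Hsol Vv0 _; have [_ Hv] := HV _ Vv0.
apply: (closed_loop_convergence adm mu0 lphi lrho rho1 dom Hsol) => t t0.
by apply: VM; apply: Hv t0 => //; exact: Hsol.1.
Qed.
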